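(* Let $\mu$ be a Federer measure on a Besicovitch metric space $X$, $\mathcal L$ an affine subspace of $\mathbb R^n$ of dimension $s$, and $f:X\to\mathcal L$ a continuous map such that $(f,\mu)$ is good and nonplanar in $\mathcal L$. For $v\ge n$ the following are equivalent: (i) for every $u>v$ the set $\{x\in\operatorname{supp}\mu\mid f(x)\notin\mathcal W_u\}$ is nonempty; (ii) $\omega(f_*\mu)\le v$; (iii) for some (equivalently, for every) matrix $R\in M_{s+1,n+1}$ for which there is an affine isomorphism $h:\mathbb R^s\to\mathcal L$ with $(1,h(x))=(1,x)R$ for all $x\in\mathbb R^s$, the following holds: for every $j=1,\dots,n$ and every $u>\frac{v+1-j}{j}$ there is $M>0$ such that $\|Rc(w)\|>\|\pi(w)\|^{-u}$ for all $w\in\mathcal S_{n+1,j}$ with $\|\pi(w)\|>M$.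
   Context: Besicovitch: there is $N$ such that for any bounded $A\subset X$ and any family of nonempty open balls with each point of $A$ a center of one of them, some countable subfamily covers $A$ with multiplicity $\le N$. A Radon measure $\mu$ is $D$-Federer on open $U$ if $\sup\{\mu(B(y,3t))/\mu(B(y,t)) : y\in\operatorname{supp}\mu,\ B(y,3t)\subset U\}<D$; Federer if for $\mu$-a.e. $x$ some neighborhood $U$ and $D$ exist with $\mu$ $D$-Federer on $U$. $\|g\|_{\mu,B}=\sup_{B\cap\operatorname{supp}\mu}|g|$; $g$ is $(C,\alpha)$-good on $U$ w.r.t. $\mu$ if for every open ball $B'\subset U$ centered in $\operatorname{supp}\mu$ and $\varepsilon>0$, $\mu(\{y\in B'\mid|g(y)|<\varepsilon\})\le C(\varepsilon/\|g\|_{\mu,B'})^\alpha\mu(B')$. $(f,\mu)$ is good if for $\mu$-a.e. $x$ there are a neighborhood $V$ and $C,\alpha>0$ such that every linear combination of $1,f_1,\dots,f_n$ is $(C,\alpha)$-good on $V$ w.r.t. $\mu$; nonplanar in $\mathcal L$ if for every nonempty open $B$ with $\mu(B)>0$ the affine span of $f(B\cap\operatorname{supp}\mu)$ is $\mathcal L$. For $u>0$, $\mathcal W_u$ is the set of $y\in\mathbb R^n$ with infinitely many $q\in\mathbb Z^n$ such that $|\sum y_iq_i+p|<\|q\|^{-u}$ for some $p\in\mathbb Z$; $\omega(y)=\sup\{u\mid y\in\mathcal W_u\}$; for a measure $\nu$, $\omega(\nu)=\sup\{v\mid\nu(\{y\mid\omega(y)>v\})>0\}$. Exterior algebra notation: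 $V=\mathbb R^{n+1}$ with basis $e_0,\dots,e_n$, $V_0=\mathrm{span}(e_1,\dots,e_n)$; for $I=\{i_1<\dots<i_j\}$, $e_I=e_{i_1}\wedge\dots\wedge e_{i_j}$; $\bigwedge(V)$ carries the inner product making $\{e_I\}$ orthonormal. $\mathcal S_{n+1,j}$ is the set of $w=v_1\wedge\dots\wedge v_j$ with $v_1,\dots,v_j\in\mathbb Z^{n+1}$ linearly independent. $\pi$ is the orthogonal projection $\bigwedge^j(V)\to\bigwedge^j(V_0)$. For $w\in\bigwedge^j(V)$, $c(w)=(c(w)_0,\dots,c(w)_n)$ with $c(w)_i=\sum_{J\subset\{1,\dots,n\},\#J=j-1}\langle e_i\wedge e_J,w\rangle e_J$. For $R=(r_{i,k})_{0\le i\le s,0\le k\le n}$, $Rc(w)\in(\bigwedge^{j-1}V_0)^{s+1}$ has $i$-th component $\sum_k r_{i,k}c(w)_k$, with the Euclidean norm. *)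

(* Defs.v *)
From HB Require Import structures.
From mathcomp Require Import all_boot all_order all_algebra.
From mathcomp Require Import all_classical all_reals all_analysis.

Set Implicit Arguments.
Unset Strict Implicit.
Unset Printing Implicit Defensive.

Import Order.TTheory GRing.Theory Num.Theory.
Local Open Scope classical_set_scope.
Local Open Scope ring_scope.

Section Metric.
Context {R : realType} {X : Type} (dist : X -> X -> R).

Definition is_metric : Prop :=
  [/\ forall x y, 0 <= dist x y,
      forall x y, dist x y = 0 <-> x = y,
      forall x y, dist x y = dist y x
    & forall x y z, dist x z <= dist x y + dist y z].

Definition mball (x : X) (r : R) : set X := [set y | dist x y < r].

Definition mopen (U : set X) : Prop :=
  forall x, U x -> exists2 r, 0 < r & mball x r `<=` U.

Definition mclosed (F : set X) : Prop := mopen (~` F).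

Definition mbounded (A : set X) : Prop :=
  A = set0 \/ exists x0 r, A `<=` mball x0 r.

(* Besicovitch property.  A family of balls is a set of (center, radius)
   pairs with positive radius (hence nonempty open balls). *)
Definition besicovitch : Prop :=
  exists N : nat, forall (A : set X) (F : set (X * R)),
    mbounded A ->
    (forall b, F b -> 0 < b.2) ->
    (forall a, A a -> exists r, F (a, r)) ->
    exists G : set (X * R),
      [/\ G `<=` F, countable G,
          A `<=` \bigcup_(b in G) mball b.1 b.2
        & forall (x : X) (g : 'I_N.+1 -> X * R), injective g ->
            ~ (forall k, G (g k) /\ mball (g k).1 (g k).2 x)].

Definition mcontinuous (n : nat) (f : X -> 'rV[R]_n) : Prop :=
  forall x (e : R), 0 < e -> exists2 d, 0 < d &
    forall y, dist x y < d -> forall i, `|f y 0 i - f x 0 i| < e.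

End Metric.

Section MeasureDefs.
Context {R : realType} {X : pointedType} (dist : X -> X -> R)
  (mu : {measure set (g_sigma_algebraType (mopen dist)) -> \bar R}).

Local Notation ball := (mball dist).

Definition supp : set X :=
  [set x | forall r, 0 < r -> (0 < mu (ball x r))%E].

Definition radon : Prop :=
  [/\ forall x, exists2 r, 0 < r & (mu (ball x r) < +oo)%E,
      forall A : set (g_sigma_algebraType (mopen dist)), measurable A ->
        mu A = ereal_inf [set mu U | U in [set U | mopen dist U /\ A `<=` U]]
    & forall A : set (g_sigma_algebraType (mopen dist)), measurable A ->
        mu A = ereal_sup [set mu F | F in [set F | mclosed dist F /\ F `<=` A]]].

Definition federer_on (D : R) (U : set X) : Prop :=
  (ereal_sup [set z : \bar R | exists (y : X) (t : R), [/\ supp y, (0 < t)%R,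
       ball y (3 * t)%R `<=` U &
       z = (mu (ball y (3 * t)%R) * (mu (ball y t))^-1)%E]] < D%:E)%E.

Definition federer : Prop :=
  radon /\ {ae mu, forall x, exists U D, [/\ mopen dist U, U x & federer_on D U]}.

Definition norm_mu (g : X -> R) (B : set X) : \bar R :=
  ereal_sup [set (`|g y|)%:E | y in B `&` supp].

Definition good_on (C alpha : R) (g : X -> R) (U : set X) : Prop :=
  forall (y : X) (r : R), supp y -> 0 < r -> ball y r `<=` U ->
  forall eps : R, 0 < eps ->
    (mu (ball y r `&` [set z | (`|g z| < eps)%R]) <=
     C%:E * poweR (eps%:E * (norm_mu g (ball y r))^-1) alpha * mu (ball y r))%E.

Definition good (n : nat) (f : X -> 'rV[R]_n) : Prop :=
  {ae mu, forall x, exists V C alpha,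
     [/\ mopen dist V, V x, 0 < C, 0 < alpha &
         forall (c0 : R) (c : 'rV[R]_n),
           good_on C alpha (fun y => c0 + \sum_i c 0 i * f y 0 i) V]}.

Definition aff_span (n : nat) (S : set 'rV[R]_n) : set 'rV[R]_n :=
  [set y | exists m (lam : 'I_m -> R) (p : 'I_m -> 'rV[R]_n),
     [/\ forall k, S (p k), \sum_k lam k = 1 & y = \sum_k lam k *: p k]].

Definition nonplanar (n : nat) (f : X -> 'rV[R]_n) (L : set 'rV[R]_n) : Prop :=
  forall B : set X, mopen dist B -> B !=set0 -> (0 < mu B)%E ->
    aff_span (f @` (B `&` supp)) = L.

End MeasureDefs.

Section Dioph.
Context {R : realType} {n : nat}.

Definition supn (q : 'rV[int]_n) : R := \big[Num.max/0]_i ((`|q 0 i|)%:~R).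

Definition Wset (u : R) (y : 'rV[R]_n) : Prop :=
  ~ finite_set [set q : 'rV[int]_n | q != 0 /\ exists p : int,
        `|\sum_i y 0 i * (q 0 i)%:~R + p%:~R| < supn q `^ (- u)].

Definition omega (y : 'rV[R]_n) : \bar R :=
  ereal_sup [set u%:E | u in [set u : R | 0 < u /\ Wset u y]].

Definition omega_push {X : pointedType} (dist : X -> X -> R)
  (mu : {measure set (g_sigma_algebraType (mopen dist)) -> \bar R})
  (f : X -> 'rV[R]_n) : \bar R :=
  ereal_sup [set v%:E | v in
     [set v : R | (0 < mu [set x | (v%:E < omega (f x))%E])%E]].

End Dioph.

Definition affine_subspace {R : realType} (n s : nat) (L : set 'rV[R]_n) : Prop :=
  exists (p : 'rV[R]_n) (U : 'M[R]_n),
    \rank U = s /\ L = [set x | (x - p <= U)%MS].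

Definition affine_map {R : realType} (s n : nat) (h : 'rV[R]_s -> 'rV[R]_n) : Prop :=
  exists (a : 'rV[R]_n) (B : 'M[R]_(s, n)), forall x, h x = a + x *m B.

Definition admissible {R : realType} (s n : nat) (L : set 'rV[R]_n)
  (Rm : 'M[R]_(1 + s, 1 + n)) : Prop :=
  exists h : 'rV[R]_s -> 'rV[R]_n,
    [/\ affine_map h, forall x, L (h x), forall y, L y -> exists x, h x = y,
        injective h &
        forall x, row_mx (const_mx 1 : 'rV[R]_1) (h x) =
                  row_mx (const_mx 1 : 'rV[R]_1) x *m Rm].

(* Exterior algebra of V = R^{m+1}: an element of /\(V) is given by    *)
(* its coordinates w.r.t. the orthonormal basis (e_I)_I.               *)
Section Exterior.
Context {R : realType} {m : nat}.

Definition extvec := {set 'I_m.+1} -> R.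

(* coordinates of v_1 /\ ... /\ v_j (rows of A): the e_I-coordinate is
   the minor on the columns of I (listed increasingly) *)
Definition wcoord (j : nat) (A : 'M[R]_(j, m.+1)) : extvec :=
  fun I => if #|I| == j then \det (colsub (fun k : 'I_j => nth ord0 (enum I) k) A)
           else 0.

Definition ext_dot (a b : extvec) : R := \sum_I a I * b I.

Definition ext_norm (w : extvec) : R := Num.sqrt (\sum_I w I ^+ 2).

(* orthogonal projection /\^j(V) -> /\^j(V_0), V_0 = span(e_1..e_m) *)
Definition proj0 (w : extvec) : extvec := fun I => if ord0 \in I then 0 else w I.

Definition eJ (k : nat) (J : {set 'I_m.+1}) : 'M[R]_(k, m.+1) :=
  \matrix_(a < k, l < m.+1) ((l == nth ord0 (enum J) a)%:R).

(* c(w)_i = sum_{J subset {1..m}, #J = j-1} <e_i /\ e_J, w> e_J *)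
Definition cw (j : nat) (w : extvec) (i : 'I_m.+1) : extvec :=
  fun J => if (ord0 \notin J) && (#|J| == j.-1) then
             ext_dot (wcoord (col_mx (delta_mx 0 i : 'rV[R]_m.+1) (eJ j.-1 J))) w
           else 0.

Definition Rc_norm (s : nat) (Rm : 'M[R]_(1 + s, 1 + m)) (j : nat) (w : extvec) : R :=
  Num.sqrt (\sum_(i : 'I_(1 + s)) \sum_(J : {set 'I_m.+1})
              (\sum_(k : 'I_m.+1) Rm i k * cw j w k J) ^+ 2).

Definition intmx (j : nat) (V : 'M[int]_(j, m.+1)) : 'M[R]_(j, m.+1) :=
  map_mx (fun z : int => z%:~R) V.

End Exterior.

Definition cond_iii {R : realType} (n s : nat) (v : R) (Rm : 'M[R]_(1 + s, 1 + n)) : Prop :=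
  forall j : nat, (1 <= j <= n)%N ->
  forall u : R, (v + 1 - j%:R) / j%:R < u ->
  exists2 M : R, 0 < M &
    forall V : 'M[int]_(j, n.+1), row_free (intmx (R := R) V) ->
      let w := wcoord (intmx (R := R) V) in
      M < ext_norm (proj0 w) ->
      ext_norm (proj0 w) `^ (- u) < Rc_norm Rm j w.

(* Main.v *)
(** Let [y] range over [L] and consider the lattice of vectors
    [(p + y . q, q)], whose first coordinate is expanded by [A] and whose other
    coordinates are contracted by [B].  A good rational approximation of [y] is
    a short vector of that lattice, and the norm of the multivector of a
    sublattice [w] of rank [j] is governed by [B^-j pi(w)] and
    [A B^(1-j) (1, y) c(w)], the latter being comparable to [Rc(w)] once [y]
    runs over points of [f(supp mu)] affinely spanning [L].

    If (iii) fails, some [w] has [Rc(w)] abnormally small; then for every [y] in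
    [L] the lattice has a sublattice of small covolume, hence a short vector by
    Minkowski, so [L] lies in [W_u] for some [u > v] and (i) fails.

    If (iii) holds for some [R], every sublattice is large at some point of any
    given ball; quantitative nondivergence (Kleinbock--Margulis, by induction on
    the rank along flags of sublattices) bounds the measure of the points having
    a short vector at scale [2^l] by a summable sequence, and Borel--Cantelli
    gives (ii).  That (ii) implies (i) is immediate because the support of [mu]
    has full measure. *)
Require Import Defs.
From HB Require Import structures.
From mathcomp Require Import all_boot all_order all_algebra.
From mathcomp Require Import all_classical all_reals all_analysis.
From mathcomp Require Import perm measurable_realfun.
From mathcomp Require Import zify ring lra.

Import Order.TTheory GRing.Theory Num.Theory.
Local Open Scope classical_set_scope.
Local Open Scope ring_scope.

Set Implicit Arguments.
Unset Strict Implicit.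
Unset Printing Implicit Defensive.

(** * Besicovitch coverings *)

(** The multivector of a sublattice is measured by its largest minor instead of its Euclidean norm.
    For fixed columns a minor of [V *m flow A B y] is affine in [y], so the goodness hypothesis
    applies to it directly, and changes of basis and added rows act on minors through determinants
    and Laplace expansion.

    The exponent in (iii) comes from balancing the two parts of a multivector of rank j when A =
    B^v. If |pi(w)| is at least B^j up to a constant, the contracted part is already large.
    Otherwise Rc(w) is at least about B^(-ju), and A B^(1-j) B^(-ju) is constant exactly for u =
    (v+1-j)/j. In rank n+1 the covolume is A B^(-n) times a nonzero integer, and v >= n keeps it at
    least 1.

    The sets of exceptional points are not shown to be measurable, so smallness is always expressed
    by a measurable set [Z] enclosing them. The space is not assumed separable; Besicovitch
    coverings are what makes locally null sets null. *)

Section MetricMeasure.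
Context {R : realType} {X : pointedType} (dist : X -> X -> R).
Context (mu : {measure set (g_sigma_algebraType (mopen dist)) -> \bar R}).
Hypothesis dist_metric : is_metric dist.

Local Notation ball := (mball dist).
Local Notation T := (g_sigma_algebraType (mopen dist)).
Local Notation meas := (@measurable _ T).

Lemma mball_center x r : 0 < r -> ball x r x.
Proof. by case: dist_metric => _ d0 _ _ r0; rewrite /mball /= (d0 x x).2. Qed.

Lemma mball_sub x y r t : dist x y + r <= t -> ball y r `<=` ball x t.
Proof.
case: dist_metric => _ _ _ tri h z /= yz; apply: le_lt_trans (tri x y z) _.
by apply: lt_le_trans h; rewrite ltrD2l.
Qed.

Lemma mball_le x r t : r <= t -> ball x r `<=` ball x t.
Proof. by move=> rt z /= /lt_le_trans; apply. Qed.

Lemma mopen_mball x r : mopen dist (ball x r).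
Proof.
move=> y /= xy; exists (r - dist x y); first by rewrite subr_gt0.
by apply: mball_sub; rewrite addrC subrK.
Qed.

Lemma mopenI U W : mopen dist U -> mopen dist W -> mopen dist (U `&` W).
Proof.
move=> oU oW x [/oU[r r0 hr] /oW[t t0 ht]]; exists (Num.min r t).
  by rewrite lt_min r0.
by move=> z hz; split; [apply: hr|apply: ht]; apply: mball_le hz;
  rewrite ge_min lexx ?orbT.
Qed.

Lemma measurable_mopen U : mopen dist U -> meas U.
Proof. exact: sub_sigma_algebra. Qed.

Lemma measurable_mball x r : meas (ball x r).
Proof. by apply: measurable_mopen; apply: mopen_mball. Qed.

End MetricMeasure.

Section Multiplicity.
Context d (T : measurableType d) {R : realType}.
Context (mu : {measure set T -> \bar R}).

(** Integrate over [W] the number of sets containing a point, which the multiplicity hypothesis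
    bounds by [N]. *)
Lemma sum_measure_multiplicity (N m : nat) (E : nat -> set T) (W : set T) :
  measurable W -> (forall i, measurable (E i)) -> (forall i, E i `<=` W) ->
  (forall x (g : 'I_N.+1 -> nat), injective g -> ~ forall k, E (g k) x) ->
  (\sum_(0 <= i < m) mu (E i) <= N%:R%:E * mu W)%E.
Proof.
move=> mW mE EW mult.
have -> : (\sum_(0 <= i < m) mu (E i) =
  \int[mu]_(x in W) (\sum_(0 <= i < m) (\1_(E i) x)%:E))%E.
  rewrite ge0_integral_sum//.
  - apply: eq_bigr => i _; rewrite integral_indic// setIidl//; exact: EW.
  - by move=> i; apply/measurable_EFinP; exact: measurable_indic.
rewrite -(@integral_cst _ _ _ mu W mW N%:R%:E).
apply: ge0_le_integral => //.
- by move=> x _; apply: sume_ge0 => i _; rewrite lee_fin.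
- by apply: emeasurable_sum => i; apply/measurable_EFinP; exact: measurable_indic.
move=> x _ /=; rewrite sumEFin lee_fin.
(* The indices of the sets through [x]; more than [N] of them would enumerate an injective [g]. *)
pose s := [seq i <- index_iota 0 m | x \in E i].
have -> : \sum_(0 <= i < m) \1_(E i) x = (size s)%:R :> R.
  rewrite -sum1_size /s big_filter natr_sum [RHS]big_mkcond /=.
  by apply: eq_bigr => i _; rewrite indicE; case: (x \in E i).
rewrite ler_nat leqNgt; apply/negP => sN.
have us : uniq s by rewrite filter_uniq // iota_uniq.
apply: (mult x (fun k : 'I_N.+1 => nth 0%N s k)).
  move=> k l /eqP; rewrite nth_uniq //; last 2 first.
    exact: leq_trans (ltn_ord k) _.
    exact: leq_trans (ltn_ord l) _.
  by move/eqP/val_inj.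
move=> k; have : nth 0%N s k \in s by rewrite mem_nth// (leq_trans (ltn_ord k)).
by rewrite mem_filter => /andP[/set_mem].
Qed.

End Multiplicity.

Section Covering.
Context {R : realType} {X : pointedType} (dist : X -> X -> R).
Context (mu : {measure set (g_sigma_algebraType (mopen dist)) -> \bar R}).
Hypothesis dist_metric : is_metric dist.

Local Notation ball := (mball dist).
Local Notation T := (g_sigma_algebraType (mopen dist)).
Local Notation meas := (@measurable _ T).

Definition besicovitch_with (N : nat) : Prop :=
  forall (A : set X) (F : set (X * R)),
    mbounded dist A ->
    (forall b, F b -> 0 < b.2) ->
    (forall a, A a -> exists r, F (a, r)) ->
    exists G : set (X * R),
      [/\ G `<=` F, countable G,
          A `<=` \bigcup_(b in G) ball b.1 b.2
        & forall (x : X) (g : 'I_N.+1 -> X * R), injective g ->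
            ~ (forall k, G (g k) /\ ball (g k).1 (g k).2 x)].

(* Enclosing the covered set in a measurable [Z] makes measurability of [Q]
   irrelevant; [K = 0] covers by null sets even when [mu W] is infinite. *)
Lemma besicovitch_cover (N : nat) (A Q : set X) (W : set T) (K : R)
    (F : set (X * R)) :
  besicovitch_with N -> mbounded dist A -> meas W -> 0 <= K ->
  (forall b, F b -> [/\ 0 < b.2, ball b.1 b.2 `<=` W & exists Z : set T,
     [/\ meas Z, (mu Z <= K%:E * mu (ball b.1 b.2))%E &
         ball b.1 b.2 `&` Q `<=` Z]]) ->
  (forall a, A a -> exists r, F (a, r)) ->
  exists Z : set T, [/\ meas Z, (mu Z <= (K * N%:R)%:E * mu W)%E & A `&` Q `<=` Z].
Proof.
move=> bes bA mW K0 hF AF.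
have [G [GF cG AG mult]] := bes A F bA (fun b Fb => let: And3 b0 _ _ := hF b Fb in b0) AF.
have /choice[Z hZ] : forall b : X * R, exists Z : set T, F b -> [/\ meas Z,
    (mu Z <= K%:E * mu (ball b.1 b.2))%E & ball b.1 b.2 `&` Q `<=` Z].
  move=> b; have [Fb|nF] := pselect (F b); last by exists set0.
  by have [_ _ [Z hZ]] := hF b Fb; exists Z.
have /countable_injP[c cinj] := cG.
have cE b b' : G b -> G b' -> c b = c b' -> b = b'.
  by move=> Gb Gb'; apply: cinj; rewrite inE.
(* Along the injective coding [c], [sel n S] is [S b] for the ball [b] of code [n], and empty if
   there is none. The cover becomes a sequence. *)
pose sel n (S : X * R -> set T) : set T := [set x | exists b, [/\ G b, c b = n & S b x]].
pose B b : set T := ball b.1 b.2.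
have selP n : (sel n Z = set0 /\ sel n B = set0) \/
    exists b, [/\ G b, sel n Z = Z b & sel n B = B b].
  have [[b [Gb cb]]|nex] := pselect (exists b, G b /\ c b = n); last first.
    by left; split; apply/seteqP; split => x //= [b [Gb cb _]]; apply: nex; exists b.
  have selb S : sel n S = S b.
    apply/seteqP; split => x /=; last by exists b.
    by move=> [b' [Gb' cb' Sx]]; rewrite (cE _ _ Gb Gb')// cb cb'.
  by right; exists b; rewrite !selb.
have mB n : meas (sel n B).
  by have [[_ ->]|[b [Gb _ ->]]] := selP n; [exact: measurable0|exact: measurable_mball].
have mZ n : meas (sel n Z).
  have [[-> _]|[b [Gb -> _]]] := selP n; first exact: measurable0.
  by have [] := hZ b (GF b Gb).
have ZB n : (mu (sel n Z) <= K%:E * mu (sel n B))%E.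
  have [[-> ->]|[b [Gb -> ->]]] := selP n; first by rewrite measure0 mule0.
  by have [] := hZ b (GF b Gb).
exists (\bigcup_n sel n Z); split.
- exact: bigcup_measurable.
- have /le_trans -> // : (mu (\bigcup_n sel n Z) <= \sum_(n <oo) mu (sel n Z))%E.
    by apply: measure_sigma_subadditive => //; exact: bigcup_measurable.
  apply: lime_le; first by apply: is_cvg_nneseries => n _ _; exact: measure_ge0.
  apply: nearW => m.
  apply: (@le_trans _ _ (\sum_(0 <= i < m) K%:E * mu (sel i B))%E).
    by apply: lee_sum => i _; exact: ZB.
  rewrite -ge0_sume_distrr; last by move=> i _; exact: measure_ge0.
  rewrite EFinM -muleA; apply: lee_wpmul2l; first by rewrite lee_fin.
  apply: sum_measure_multiplicity => //.
  + move=> i x [b [Gb _ Bx]]; have [_ + _] := hF b (GF b Gb); exact.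
  + move=> x g ginj hg.
    have /choice[h hh] k := hg k.
    apply: (mult x h) => [k l hkl|k].
      apply: ginj; have [_ <- _] := hh k; have [_ <- _] := hh l; by rewrite hkl.
    by have [? _ ?] := hh k.
- move=> a [Aa Qa]; have [b Gb ab] := AG a Aa.
  exists (c b) => //; exists b; split => //.
  by have [_ _ ] := hZ b (GF b Gb); apply.
Qed.

(** The Besicovitch property plays the part of Lindelöf's theorem. It only covers bounded sets, so
    [A] is cut by the balls around a base point. *)
Lemma negligible_cover (A Q : set X) :
  besicovitch dist ->
  (forall a, A a -> exists2 r, 0 < r & mu.-negligible (ball a r `&` Q : set T)) ->
  mu.-negligible (A `&` Q : set T).
Proof.
move=> [N bes] hA.
pose x0 : X := point.
pose Ak k := A `&` ball x0 k%:R.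
have -> : A `&` Q = \bigcup_k (Ak k `&` Q).
  apply/seteqP; split => [x [Ax Qx]|x [k _ [[Ax _] Qx]]//].
  exists (Num.bound (dist x0 x)) => //; split => //; split => //=.
  case: dist_metric => d0 _ _ _.
  by rewrite /mball /=; apply: le_lt_trans (archi_boundP (d0 x0 x)).
apply: negligible_bigcup => k.
pose F : set (X * R) := [set b | 0 < b.2 /\ mu.-negligible (ball b.1 b.2 `&` Q : set T)].
have [|||Z [mZ Z0 hZ]] := @besicovitch_cover N (Ak k) Q setT 0 F bes _ measurableT (lexx 0).
- by right; exists x0, k%:R => x [].
- move=> b [b0 [Z [mZ Z0 hZ]]]; split => //; exists Z; split => //.
  by rewrite Z0 mul0e.
- by move=> a [/hA[r r0 hr] _]; exists r.
exists Z; split => //; apply/eqP; rewrite -measure_le0.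
by rewrite (le_trans Z0)// mul0r mul0e.
Qed.

Lemma negligible_compl_supp : besicovitch dist -> mu.-negligible (~` supp mu : set T).
Proof.
move=> bes; rewrite -[~` _]setIT; apply: negligible_cover => // a.
move=> /existsNP[r /not_implyP[r0 /negP]]; rewrite -leNgt => h.
exists r => //; exists (ball a r); split; first exact: measurable_mball.
  by apply/eqP; rewrite -measure_le0.
by move=> ? [].
Qed.

End Covering.

(** * Quantitative nondivergence *)

Section Nondivergence.
Context {R : realType} {X : pointedType} (dist : X -> X -> R).
Context (mu : {measure set (g_sigma_algebraType (mopen dist)) -> \bar R}).
Hypothesis dist_metric : is_metric dist.

Local Notation ball := (mball dist).
Local Notation T := (g_sigma_algebraType (mopen dist)).
Local Notation meas := (@measurable _ T).
Local Notation sup := (supp mu).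

Context (S : Type) (rk : S -> nat) (cmp : S -> S -> Prop) (psi : S -> X -> R).
Hypothesis cmp_refl : forall s, cmp s s.
Hypothesis cmp_sym : forall s t, cmp s t -> cmp t s.

(* [F] is a flag.  Flags are indexed by ranks instead of by a partial order, so
   [cmp] may be the comparability relation of a mere preorder; the threshold
   [rho] of Kleinbock and Margulis is normalised to [1]. *)
Definition marked (eps : R) (P : S -> Prop) (z : X) : Prop :=
  exists F : S -> Prop,
    [/\ forall s, F s -> P s /\ eps <= psi s z < 1,
        forall s t, F s -> F t -> cmp s t &
        forall s, P s -> (forall t, F t -> cmp s t /\ rk s <> rk t) -> 1 <= psi s z].

(** A step costs the multiplicity [N], one factor [D] for passing from [ball y t] to
    [ball y (3 * t)] and one for [ball x (3 * r)] against [ball x r]. The summand 1 pays for the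
    single function that joins the flag. *)
Fixpoint nondiv_const (N : nat) (D : R) (k : nat) : R :=
  if k is k'.+1 then N%:R * D ^+ 2 * (nondiv_const N D k' + 1) else 0.

Lemma nondiv_const_ge0 N D k : 0 <= D -> 0 <= nondiv_const N D k.
Proof.
by move=> D0; elim: k => //= k ih; rewrite !mulr_ge0 ?exprn_ge0// addr_ge0.
Qed.

(** Induction on the number of ranks still available to the flag. A point where every [psi s] is at
    least 1 is marked by the empty flag. Around any other point of the support one member [s1] joins
    the flag on a whole ball, and the induction goes on with the members comparable to [s1].
    Exceptional points are those left by the induction and those where [psi s1] drops below [eps];
    Besicovitch sums over the balls. *)
Lemma nondivergence (N : nat) (D K eps : R) (U : set X) (P0 : S -> Prop) :
  besicovitch_with dist N -> 0 <= D -> 0 <= K -> eps <= 1 ->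
  (forall y t, sup y -> 0 < t -> ball y (3 * t) `<=` U ->
     (mu (ball y (3 * t)) <= D%:E * mu (ball y t))%E) ->
  (forall s z, P0 s -> psi s z < 1 ->
     exists2 t, 0 < t & forall z', ball z t z' -> psi s z' < 1) ->
  (forall s y t, P0 s -> sup y -> 0 < t -> ball y t `<=` U ->
     (exists z, [/\ ball y t z, sup z & 1 <= psi s z]) ->
     exists Z : set T, [/\ meas Z, (mu Z <= K%:E * mu (ball y t))%E &
       forall z, ball y t z -> psi s z < eps -> Z z]) ->
  forall (k : nat) (ks : seq nat) (P : S -> Prop), (size ks <= k)%N ->
  (forall s, P s -> P0 s /\ rk s \in ks) ->
  forall x r, sup x -> 0 < r -> ball x (10 ^+ k * r) `<=` U ->
  (forall s, P s -> exists z, [/\ ball x r z, sup z & 1 <= psi s z]) ->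
  exists Z : set T,
    [/\ meas Z, (mu Z <= (nondiv_const N D k * K)%:E * mu (ball x r))%E &
      forall z, ball x r z -> sup z -> ~ Z z -> marked eps P z].
Proof.
move=> bes D0 K0 eps1 fed cont goodP; elim=> [|k IH] ks P.
  rewrite leqn0 size_eq0 => /eqP-> hP x r _ _ _ _; exists set0.
  rewrite measure0 /= mul0r mul0e; split => // z _ _ _.
  by exists (fun=> False); split => // s /hP[].
move=> sks hP x r supx r0 xU hlarge.
have dsym x' y' : dist x' y' = dist y' x' by case: dist_metric.
pose E : set X := [set y | [/\ ball x r y, sup y & exists2 s, P s & psi s y < 1]].
pose c := nondiv_const N D k.
have c0 : 0 <= c by exact: nondiv_const_ge0.
pose Bad : set X := [set z | ball x r z /\ ~ marked eps P z].
have rU t : t <= 10 * r -> ball x t `<=` U.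
  move=> tr; apply: subset_trans xU; apply: mball_le; apply: le_trans tr _.
  rewrite ler_pM2r// exprS -[leLHS]mulr1 ler_pM2l//.
  by rewrite exprn_ege1// ler1n.
pose Fam : set (X * R) := [set b | [/\ 0 < b.2, ball b.1 b.2 `<=` ball x (3 * r) &
   exists Z : set T, [/\ meas Z, (mu Z <= ((c + 1) * K * D)%:E * mu (ball b.1 b.2))%E &
         ball b.1 b.2 `&` (sup `&` ~` marked eps P) `<=` Z]]].
have [|||||Z [mZ muZ EZ]] := @besicovitch_cover _ _ _ mu dist_metric N E
    (sup `&` ~` marked eps P) (ball x (3 * r)) ((c + 1) * K * D) Fam bes.
- by right; exists x, r => y [].
- exact: measurable_mball.
- by rewrite !mulr_ge0// addr_ge0.
- by move=> b [].
- move=> y [xy supy [s0 Ps0 s0y]].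
  (* [t] is nearly the largest radius at which some [psi s] stays below [1]:
     on [ball y t] the function [psi s1] is small, whereas every [psi s] is
     large somewhere on [ball y (3 * t)], where the induction applies. *)
  pose Ts : set R := [set t | 0 < t /\ exists2 s, P s &
     forall z, ball y t z -> sup z -> psi s z < 1].
  have Tub t : Ts t -> t < 2 * r.
    move=> [t0 [s Ps hs]]; rewrite ltNge; apply/negP => rt.
    have [z [xz supz]] := hlarge s Ps; apply/negP; rewrite -ltNge; apply: hs => //.
    apply: lt_le_trans rt; case: dist_metric => _ _ _ tri.
    apply: le_lt_trans (tri _ x _) _; rewrite mulr_natl mulr2n ltrD//.
    by rewrite dsym.
  have hTs : has_sup Ts.
    split; last by exists (2 * r) => t /Tub/ltW.
    have [t t0 ht] := cont s0 y (hP _ Ps0).1 s0y.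
    by exists t; split => //; exists s0 => // z /ht.
  have [t0 t0T] : exists t, Ts t by case: hTs.
  have tau0 : 0 < reals.sup Ts.
    by apply: lt_le_trans (sup_upper_bound hTs t0T); case: t0T.
  have [t tT tau_t] : exists2 t, Ts t & reals.sup Ts < 3 * t.
    have tau3 : 0 < reals.sup Ts * (2 / 3) by rewrite mulr_gt0// divr_gt0.
    have [t tT ht] := sup_adherent tau3 hTs.
    by exists t => //; move: ht tau0; lra.
  have t3 : 0 < 3 * t by apply: lt_trans tau_t.
  have xyt : dist x y < r by [].
  have t2r := Tub _ tT.
  have large3 s : P s -> exists z, [/\ ball y (3 * t) z, sup z & 1 <= psi s z].
    move=> Ps; apply: contrapT => nz.
    have : Ts (3 * t).
      split => //; exists s => // z yz sz; rewrite ltNge; apply/negP => h.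
      by apply: nz; exists z.
    by move/(sup_upper_bound hTs); rewrite leNgt tau_t.
  have [tpos [s1 Ps1 hs1]] := tT.
  have [P0s1 rs1] := hP _ Ps1.
  have p10 : (1 : R) <= 10 ^+ k by rewrite exprn_ege1// ler1n.
  (* The centre moves by less than [r] and 3t < 6r; since 1 + 6 * 10^k <= 10^(k+1), a radius factor
     of 10 per rank suffices. *)
  have y3U : ball y (10 ^+ k * (3 * t)) `<=` U.
    apply: subset_trans xU; apply: mball_sub => //; rewrite exprS.
    have : 0 <= (10 ^+ k - 1) * r by rewrite mulr_ge0 ?subr_ge0// ltW.
    have : 10 ^+ k * t <= 10 ^+ k * (2 * r) by rewrite ler_pM2l ?exprn_gt0// ltW.
    by move: xyt; lra.
  have y3U' : ball y (3 * t) `<=` U.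
    by apply: subset_trans y3U; apply: mball_le; rewrite ler_peMl// ltW.
  (* Only members that can share a flag with [s1] remain; their ranks avoid [rk s1], so one rank
     fewer is available. *)
  pose P1 s := [/\ P s, cmp s s1 & rk s <> rk s1].
  have [|||Z1 [mZ1 muZ1 hZ1]] := IH (seq.filter (predC1 (rk s1)) ks) P1 _ _ y _ supy t3 y3U.
  + rewrite -ltnS (leq_trans _ sks)// size_filter -(count_predC (pred1 (rk s1)) ks).
    rewrite -[ltnLHS]add0n ltn_add2r -has_count; apply/hasP; exists (rk s1) => //=.
  + move=> s [/hP[P0s rs] _ /eqP rss]; split => //.
    by rewrite mem_filter rs /= rss.
  + by move=> s [Ps _ _]; exact: large3.
  have [Z2 [mZ2 muZ2 hZ2]] := goodP s1 y _ P0s1 supy t3 y3U' (large3 _ Ps1).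
  exists t; split => //.
    by apply: mball_sub => //=; move: xyt t2r; lra.
  exists (Z1 `|` Z2); split; first exact: measurableU.
    apply: le_trans (measureU2 _ _ _) _ => //.
    apply: (@le_trans _ _ (((c + 1) * K)%:E * mu (ball y (3 * t)))%E).
      rewrite mulrDl mul1r EFinD ge0_muleDl ?lee_fin ?mulr_ge0//.
      exact: leeD.
    rewrite (EFinM ((c + 1) * K) D) -muleA lee_wpmul2l ?lee_fin ?mulr_ge0 ?addr_ge0//.
    exact: fed.
  move=> z [yz [supz nmz]]; apply: contrapT => /not_orP[nZ1 nZ2].
  have yz3 : ball y (3 * t) z by apply: mball_le yz; rewrite ler_peMl ?ler1n// ltW.
  have [F [F1 F2 F3]] := hZ1 z yz3 supz nZ1.
  have es1 : eps <= psi s1 z.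
    by rewrite leNgt; apply/negP => /(hZ2 _ yz3).
  apply: nmz; exists (fun s => F s \/ s = s1); split.
  + by move=> s [/F1[[]]//|->]; split => //; rewrite es1 hs1.
  + move=> s s' [Fs|->] [Fs'|->]; [exact: F2| | |exact: cmp_refl].
      by have [[]] := F1 _ Fs.
    by apply: cmp_sym; have [[]] := F1 _ Fs'.
  + move=> s Ps hs; apply: F3 => [|s' Fs']; last by apply: hs; left.
    by have [] := hs s1 (or_intror erefl).
exists Z; split => //.
  apply: le_trans muZ _.
  apply: (@le_trans _ _ (((c + 1) * K * D * N%:R)%:E * (D%:E * mu (ball x r)))%E).
    rewrite lee_wpmul2l ?lee_fin ?mulr_ge0// ?addr_ge0//.
    by apply: fed => //; apply: rU; rewrite ler_pM2r// ler_nat.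
  rewrite muleA -EFinM lee_wpmul2r ?measure_ge0// lee_fin /= -/c.
  by rewrite le_eqVlt; apply/orP; left; apply/eqP; ring.
move=> z xz supz nZ; have [Ez|nEz] := pselect (E z).
  by apply: contrapT => nm; apply: nZ; apply: EZ.
exists (fun=> False); split => // s Ps _; rewrite leNgt; apply/negP => h.
by apply: nEz; split => //; exists s.
Qed.

End Nondivergence.

(** * Minors *)

Section Minors.
Context {R : comNzRingType}.

(** Columns are chosen by an arbitrary map, not an increasing list, so that replacing or prepending
    a column stays within the definition: repetitions give 0 and reorderings a sign. *)
Definition minor (j m : nat) (c : 'I_j -> 'I_m) (V : 'M[R]_(j, m)) : R :=
  \det (colsub c V).

Lemma eq_minor j m (c d : 'I_j -> 'I_m) (V : 'M[R]_(j, m)) :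
  c =1 d -> minor c V = minor d V.
Proof. by move=> cd; congr (\det _); apply/matrixP => a b; rewrite !mxE cd. Qed.

Lemma minor_mulmx j m (c : 'I_j -> 'I_m) (A : 'M[R]_j) (V : 'M[R]_(j, m)) :
  minor c (A *m V) = \det A * minor c V.
Proof.
rewrite /minor -det_mulmx; congr (\det _); apply/matrixP => a b.
by rewrite !mxE; apply: eq_bigr => k _; rewrite mxE.
Qed.

Lemma minor_noninj j m (c : 'I_j -> 'I_m) (V : 'M[R]_(j, m)) (a b : 'I_j) :
  a != b -> c a = c b -> minor c V = 0.
Proof.
move=> ab cab; rewrite /minor -det_tr; apply: (determinant_alternate ab) => i.
by rewrite !mxE cab.
Qed.

Lemma minor_perm j m (c : 'I_j -> 'I_m) (s : {perm 'I_j}) (V : 'M[R]_(j, m)) :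
  minor (c \o s) V = (-1) ^+ s * minor c V.
Proof.
rewrite /minor (_ : colsub _ _ = col_perm s (colsub c V)); last first.
  by apply/matrixP => a b; rewrite !mxE.
by rewrite col_permE det_mulmx det_perm odd_permV mulrC.
Qed.

Lemma minor_col_mx j m (c : 'I_(1 + j) -> 'I_m) (v : 'rV[R]_m) (V : 'M[R]_(j, m)) :
  minor c (col_mx v V) =
  \sum_l v 0 (c l) * ((-1) ^+ l * minor (c \o lift l) V).
Proof.
rewrite /minor (expand_det_row _ (ord0 : 'I_(1 + j))); apply: eq_bigr => l _.
rewrite mxE; congr (_ * _).
  have -> : ord0 = lshift j (0 : 'I_1) by apply: val_inj.
  by rewrite col_mxEu.
rewrite /cofactor add0n; congr (_ * \det _); apply/matrixP => a b; rewrite !mxE.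
case: splitP => k /=; first by case: k => [[]].
by rewrite /bump /= !add1n => -[] /val_inj ->.
Qed.

Lemma injective_enum_perm j m (c : 'I_j -> 'I_m.+1) : injective c ->
  let I := [set c a | a in 'I_j]%SET in
  #|I| = j /\ exists s : {perm 'I_j}, forall a, c a = nth ord0 (enum I) (s a).
Proof.
move=> cinj I; have cI : #|I| = j by rewrite card_imset// card_ord.
split=> //; have hin a : (index (c a) (enum I) < j)%N.
  by rewrite -[X in (_ < X)%N]cI cardE index_mem mem_enum imset_f.
have inj : injective (fun a => Ordinal (hin a)).
  move=> a b [] /(congr1 (nth ord0 (enum I))).
  by rewrite !nth_index ?mem_enum ?imset_f// => /cinj.
by exists (perm inj) => a; rewrite permE /= nth_index// mem_enum imset_f.
Qed.

End Minors.

Section ExteriorCoordinates.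
Context {R : realType} {m : nat}.

Lemma enum_nth_inj j (I : {set 'I_m.+1}) : #|I| = j ->
  injective (fun k : 'I_j => nth ord0 (enum I) k).
Proof.
move=> cI a b /eqP; rewrite nth_uniq ?enum_uniq// -?cardE ?cI//.
by move/eqP/val_inj.
Qed.

Lemma wcoord_minor j (V : 'M[R]_(j, m.+1)) (I : {set 'I_m.+1}) : #|I| = j ->
  wcoord V I = minor (fun k : 'I_j => nth ord0 (enum I) k) V.
Proof. by move=> cI; rewrite /wcoord cI eqxx. Qed.

Lemma normr_minor_wcoord j (c : 'I_j -> 'I_m.+1) (V : 'M[R]_(j, m.+1)) :
  injective c -> `|minor c V| = `|wcoord V [set c a | a in 'I_j]%SET|.
Proof.
move=> /injective_enum_perm[cI [s hs]]; rewrite wcoord_minor//.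
by rewrite (eq_minor (d := (fun k : 'I_j => nth ord0 (enum _) k) \o s) _ hs)
  minor_perm normrM normr_sign mul1r.
Qed.

(** Both sides vanish if [c] repeats a column. Otherwise only the coordinate indexed by the image of
    [c] survives, and the sorting permutation contributes its sign on both sides. *)
Lemma ext_dot_wcoord j (c : 'I_j -> 'I_m.+1) (V : 'M[R]_(j, m.+1)) :
  ext_dot (wcoord (\matrix_(a, l) (l == c a)%:R)) (wcoord V) = minor c V.
Proof.
set E := \matrix_(a, l) _.
have [cinj|] := pselect (injective c); last first.
  move=> /existsNP[a /existsNP[b /not_implyP[cab /eqP ab]]].
  rewrite (minor_noninj _ ab cab) /ext_dot big1// => I _; rewrite /wcoord.
  case: eqP => [cI|]; last by rewrite mul0r.
  by rewrite (determinant_alternate ab) ?mul0r// => i; rewrite !mxE cab.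
pose I0 : {set 'I_m.+1} := [set c a | a in 'I_j]%SET.
have [cI0 [s hs]] := injective_enum_perm cinj; rewrite -/I0 in cI0 hs.
rewrite /ext_dot (bigD1 I0)//= big1 ?addr0 => [|I II0].
  rewrite !wcoord_minor//; set d := fun k : 'I_j => _.
  rewrite (eq_minor (d := d \o s) _ hs) minor_perm; congr (_ * _).
  rewrite -det_perm; congr (\det _); apply/matrixP => a b; rewrite !mxE hs.
  by rewrite (inj_eq (enum_nth_inj cI0)) eq_sym.
rewrite /wcoord; case: eqP => [cI|]; last by rewrite mul0r.
have /subsetPn[_ /imsetP[a _ ->] nI] : ~~ (I0 \subset I).
  by apply: contra II0 => h; rewrite eq_sym eqEcard h cI cI0 leqnn.
rewrite (expand_det_row _ a) big1 ?mul0r// => l _; rewrite !mxE.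
case: eqP => [h|]; last by rewrite mul0r.
by move: nI; rewrite -h -mem_enum mem_nth// -cardE cI.
Qed.

Lemma cw_minor j (V : 'M[R]_(j.+1, m.+1)) (k : 'I_m.+1) (J : {set 'I_m.+1}) :
  ord0 \notin J -> #|J| = j ->
  cw j.+1 (wcoord V) k J = minor (fun a : 'I_j.+1 => nth ord0 (k :: enum J) a) V.
Proof.
move=> J0 cJ; rewrite /cw J0 cJ eqxx /= -ext_dot_wcoord; congr (ext_dot (wcoord _) _).
apply/matrixP => a b; rewrite !mxE; case: splitP => [i|i ->] /=.
  by rewrite (ord1 i) => ->; rewrite mxE eqxx.
by rewrite mxE.
Qed.

End ExteriorCoordinates.

Section MaximalMinor.
Context {R : realType}.

(** Stands for the norm of the multivector of the rows. In rank 0 it equals 1, the covolume of the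
    zero lattice. *)
Definition maxminor (j m : nat) (G : 'M[R]_(j, m)) : R :=
  \big[Num.max/0]_(c : {ffun 'I_j -> 'I_m}) `|minor c G|.

Lemma minor_le_maxminor j m (c : 'I_j -> 'I_m) (G : 'M[R]_(j, m)) :
  `|minor c G| <= maxminor G.
Proof.
rewrite (eq_minor (d := finfun c)); last by move=> a; rewrite ffunE.
exact: le_bigmax.
Qed.

Lemma maxminor_le j m (G : 'M[R]_(j, m)) (M : R) : 0 <= M ->
  (forall c : {ffun 'I_j -> 'I_m}, `|minor c G| <= M) -> maxminor G <= M.
Proof. by move=> M0 h; apply: bigmax_le. Qed.

Lemma maxminor_ge0 j m (G : 'M[R]_(j, m)) : 0 <= maxminor G.
Proof. exact: bigmax_ge_id. Qed.

Lemma le_maxminorP j m (G : 'M[R]_(j, m)) (M : R) : 0 < M -> M <= maxminor G ->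
  exists c : {ffun 'I_j -> 'I_m}, M <= `|minor c G|.
Proof.
move=> M0 MG; apply: contrapT => /forallNP h; move: MG; apply/negP.
rewrite -ltNge; apply: bigmax_lt => // c _; rewrite ltNge; exact/negP.
Qed.

Lemma maxminor_mulmx j m (A : 'M[R]_j) (G : 'M[R]_(j, m)) :
  maxminor (A *m G) = `|\det A| * maxminor G.
Proof.
apply/le_anti/andP; split.
  apply: maxminor_le; first by rewrite mulr_ge0// maxminor_ge0.
  move=> c; rewrite minor_mulmx normrM ler_wpM2l//; exact: minor_le_maxminor.
have [->|dA] := eqVneq (\det A) 0; first by rewrite normr0 mul0r maxminor_ge0.
rewrite mulrC -ler_pdivlMr ?normr_gt0//; apply: maxminor_le => [|c].
  by rewrite divr_ge0// maxminor_ge0.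
by rewrite ler_pdivlMr ?normr_gt0// mulrC -normrM -minor_mulmx minor_le_maxminor.
Qed.

Lemma maxminor_col_mx j m (v : 'rV[R]_m) (G : 'M[R]_(j, m)) (e : R) : 0 <= e ->
  (forall l, `|v 0 l| <= e) ->
  maxminor (col_mx v G) <= j.+1%:R * e * maxminor G.
Proof.
move=> e0 ve; have M0 := maxminor_ge0 G.
apply: maxminor_le => [|c]; first by rewrite !mulr_ge0.
rewrite minor_col_mx; apply: le_trans (ler_norm_sum _ _ _) _.
apply: (@le_trans _ _ (\sum_(l < 1 + j) e * maxminor G)).
  apply: ler_sum => l _; rewrite !normrM normrX normrN1 expr1n mul1r.
  by apply: ler_pM => //; exact: minor_le_maxminor.
by rewrite sumr_const card_ord -[leLHS]mulr_natl mulrA.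
Qed.

Lemma maxminor0 m (G : 'M[R]_(0, m)) : maxminor G = 1.
Proof.
apply/le_anti/andP; split.
  by apply: maxminor_le => // c; rewrite /minor det_mx00 normr1.
apply: le_trans (minor_le_maxminor (fun i : 'I_0 => False_rect _ (notF (ltn_ord i))) G).
by rewrite /minor det_mx00 normr1.
Qed.

Lemma row_free_minor j m (G : 'M[R]_(j, m)) : row_free G ->
  exists c : 'I_j -> 'I_m, minor c G != 0.
Proof.
move=> fG; have fT : row_full G^T by rewrite /row_full mxrank_tr.
exists (fullrankfun fT); rewrite /minor -det_tr -unitfE -unitmxE.
have := fullrowsub_unit fT.
rewrite (_ : rowsub _ _ = (colsub (fullrankfun fT) G)^T)//.
by apply/matrixP => a b; rewrite !mxE.
Qed.

Lemma intr_norm_ge1 (z : int) : z%:~R != 0 :> R -> 1 <= `|z%:~R : R|.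
Proof. by rewrite intr_eq0 -intr_norm => z0; rewrite (ler_int _ 1) -gtz0_ge1 normr_gt0. Qed.

Lemma minor_intmx j m (V : 'M[int]_(j, m.+1)) (c : 'I_j -> 'I_m.+1) :
  minor c (intmx V) = (minor c V)%:~R :> R.
Proof.
by rewrite /minor -(det_map_mx intr); congr (\det _); apply/matrixP => a b; rewrite !mxE.
Qed.

Lemma minor_intmx_ge1 j m (V : 'M[int]_(j, m.+1)) (c : 'I_j -> 'I_m.+1) :
  minor c (intmx V) != 0 :> R -> 1 <= `|minor c (intmx V) : R|.
Proof. by rewrite minor_intmx; exact: intr_norm_ge1. Qed.

(* Substitute for primitivity of the sublattice spanned by the rows of [V]: no
   integral basis of the same real subspace has smaller covolume. *)
Definition minimal_basis j m (V : 'M[int]_(j, m.+1)) : Prop :=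
  row_free (intmx V : 'M[R]_(j, m.+1)) /\
  forall (V' : 'M[int]_(j, m.+1)) (A : 'M[R]_j),
    intmx V' = A *m intmx V -> \det A != 0 -> 1 <= `|\det A|.

(** Fix a nonvanishing minor. Over all integer bases of the same real subspace its absolute values
    are positive integers, so one basis attains the minimum, and a change of basis multiplies the
    minor by the determinant. *)
Lemma minimal_basis_exists j m (V : 'M[int]_(j, m.+1)) :
  row_free (intmx V : 'M[R]_(j, m.+1)) ->
  exists2 V' : 'M[int]_(j, m.+1), minimal_basis V' &
    exists2 A : 'M[R]_j, A \in unitmx & intmx V' = A *m intmx V.
Proof.
move=> fV; have [c c0] := row_free_minor fV.
pose P k := `[<exists (V' : 'M[int]_(j, m.+1)) (A : 'M[R]_j),
  [/\ A \in unitmx, intmx V' = A *m intmx V & absz (minor c V') = k]>].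
have exP : exists k, P k.
  exists (absz (minor c V)); apply/asboolP; exists V, 1%:M; split => //.
    exact: unitmx1.
  by rewrite mul1mx.
case: (ex_minnP exP) => k /asboolP[V' [A [uA VA Vk]]] kmin.
exists V'; last by exists A.
have normE (W : 'M[int]_(j, m.+1)) : `|minor c (intmx W) : R| = (absz (minor c W))%:R.
  by rewrite minor_intmx -intr_norm natr_absz.
split=> [|V'' A' VA' dA'].
  by rewrite VA /row_free mxrankMfree ?row_free_unit// mxrank_unit.
have uA' : A' \in unitmx by rewrite unitmxE unitfE.
have /kmin : P (absz (minor c V'')).
  apply/asboolP; exists V'', (A' *m A); split => //.
    by rewrite unitmx_mul uA' uA.
  by rewrite VA' VA mulmxA.
rewrite -(ler_nat R) -Vk -!normE VA' minor_mulmx normrM -ler_pdivrMr ?divff//.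
  by rewrite normr_eq0 VA minor_mulmx mulf_neq0// -unitfE -unitmxE.
by rewrite normr_gt0 VA minor_mulmx mulf_neq0// -unitfE -unitmxE.
Qed.

End MaximalMinor.

(** * Short lattice vectors *)

Section Flow.
Context {R : realType} {n : nat}.

Definition homog (y : 'rV[R]_n) : 'rV[R]_n.+1 := row_mx (const_mx 1 : 'rV[R]_1) y.

(* The row [(p, q) *m flow A B y] is [(A (p + q . y), B^-1 q)]. *)
Definition flow (A B : R) (y : 'rV[R]_n) : 'M[R]_n.+1 :=
  \matrix_(k, l) if l == ord0 then A * homog y 0 k else B^-1 *+ (k == l).

Lemma homog0 y : homog y 0 ord0 = 1.
Proof.
have -> : ord0 = lshift n (0 : 'I_1) by apply: val_inj.
by rewrite /homog; apply: etrans (row_mxEl _ _ _ _) _; rewrite mxE.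
Qed.

Lemma homog_lift y k : homog y 0 (lift ord0 k) = y 0 k.
Proof.
have -> : lift ord0 k = rshift 1 k by apply: val_inj.
exact: row_mxEr.
Qed.

Lemma homog_sum y (w : 'I_n.+1 -> R) :
  \sum_k w k * homog y 0 k = w ord0 + \sum_i w (lift ord0 i) * y 0 i.
Proof.
rewrite big_ord_recl homog0 mulr1; congr (_ + _).
by apply: eq_bigr => i _; rewrite homog_lift.
Qed.

Lemma mulmx_flow A B y j (V : 'M[R]_(j, n.+1)) i l :
  (V *m flow A B y) i l =
  if l == ord0 then A * \sum_k V i k * homog y 0 k else B^-1 * V i l.
Proof.
rewrite mxE; case: eqP => [->|/eqP l0].
  rewrite mulr_sumr; apply: eq_bigr => k _.
  by rewrite mxE eqxx mulrCA.
rewrite (bigD1 l)//= big1 ?addr0 => [|k kl]; rewrite mxE (negbTE l0).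
  by rewrite eqxx mulrC.
by rewrite (negbTE kl) mulr0.
Qed.

(** Only column 0 of the flowed matrix depends on [y], and affinely; a minor with distinct columns
    contains that column at most once and is linear in it. *)
Lemma minor_flow_affine A B j (V : 'M[R]_(j, n.+1)) (c : 'I_j -> 'I_n.+1) :
  exists (c0 : R) (b : 'rV[R]_n), forall y,
    minor c (V *m flow A B y) = c0 + \sum_i b 0 i * y 0 i.
Proof.
have cstP : (forall y, minor c (V *m flow A B y) = minor c (V *m flow A B 0)) ->
    exists (c0 : R) (b : 'rV[R]_n), forall y,
      minor c (V *m flow A B y) = c0 + \sum_i b 0 i * y 0 i.
  move=> h; exists (minor c (V *m flow A B 0)), 0 => y.
  by rewrite h big1 ?addr0// => i _; rewrite mxE mul0r.
have [cinj|] := pselect (injective c); last first.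
  move=> /existsNP[a /existsNP[b /not_implyP[cab /eqP ab]]].
  by apply: cstP => y; rewrite !(minor_noninj _ ab cab).
have [[a ca]|nex] := pselect (exists a, c a = ord0); last first.
  apply: cstP => y; congr (\det _); apply/matrixP => i b.
  rewrite [LHS]mxE [RHS]mxE !mulmx_flow; case: eqP => // cb.
  by case: nex; exists b.
pose cof i := cofactor (colsub c (V *m flow A B 0)) i a.
exists (\sum_i A * V i ord0 * cof i), (\row_k \sum_i A * V i (lift ord0 k) * cof i) => y.
rewrite /minor (expand_det_col _ a).
transitivity (\sum_i A * (V i ord0 + \sum_k V i (lift ord0 k) * y 0 k) * cof i).
  apply: eq_bigr => i _; congr (_ * _).
    by rewrite mxE mulmx_flow ca eqxx homog_sum.
  rewrite /cof /cofactor; congr (_ * \det _); apply/matrixP => k l.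
  do 3! rewrite [LHS]mxE [RHS]mxE.
  rewrite !mulmx_flow; case: eqP => // cl.
  by have /eqP := cinj _ _ (etrans cl (esym ca)); rewrite eq_sym (negbTE (neq_lift _ _)).
transitivity (\sum_i A * V i ord0 * cof i +
    \sum_i \sum_k A * V i (lift ord0 k) * cof i * y 0 k).
  rewrite -big_split; apply: eq_bigr => i _ /=.
  rewrite mulrDr mulrDl; congr (_ + _).
  rewrite mulr_sumr mulr_suml; apply: eq_bigr => k _; ring.
congr (_ + _); rewrite exchange_big; apply: eq_bigr => k _ /=.
by rewrite mxE mulr_suml.
Qed.

End Flow.

Section ShortVectors.
Context {R : realType} {n : nat}.

(** A sublattice is given by a basis with its rank as tag. Several bases may span the same space, so
    [lattice_cmp] is only comparability for a preorder. *)
Definition lattice : Type := {j : nat & 'M[int]_(j, n.+1)}.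

Definition lmx (s : lattice) : 'M[R]_(tag s, n.+1) := intmx (tagged s).

Definition lattice_cmp (s t : lattice) : Prop :=
  (lmx s <= lmx t)%MS \/ (lmx t <= lmx s)%MS.

Definition lattice_minimal (s : lattice) : Prop :=
  (0 < tag s)%N /\ minimal_basis (R := R) (tagged s).

Lemma row_free_unit_factor j (V W : 'M[R]_(j, n.+1)) :
  row_free W -> (W <= V)%MS -> exists2 A : 'M[R]_j, \det A != 0 & W = A *m V.
Proof.
move=> fW WV; exists (W *m pinvmx V); last by rewrite mulmxKpV.
rewrite -unitfE -unitmxE -row_free_unit /row_free eqn_leq rank_leq_row /=.
have := mxrankM_maxl (W *m pinvmx V) V; rewrite mulmxKpV//. by rewrite (eqP fW).
Qed.

(** The ratio of the two sides is |det A| for the change of basis [A], hence the comparison holds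
    for all [G] at once. *)
Lemma maxminor_minimal j (V W : 'M[int]_(j, n.+1)) (G : 'M[R]_n.+1) :
  minimal_basis (R := R) V -> row_free (intmx W : 'M[R]_(j, n.+1)) ->
  (intmx W <= (intmx V : 'M[R]_(j, n.+1)))%MS ->
  maxminor (intmx V *m G) <= maxminor (intmx W *m G).
Proof.
move=> [_ minV] fW WV; have [A dA WA] := row_free_unit_factor fW WV.
rewrite WA -mulmxA maxminor_mulmx ler_peMl ?maxminor_ge0//; exact: minV WA dA.
Qed.

Lemma marked_no_short_vector (X : pointedType) (G : X -> 'M[R]_n.+1) (eps : R) (z : X)
    (v : 'rV[int]_n.+1) :
  0 < eps -> eps <= 1 ->
  marked (@tag _ _) lattice_cmp (fun s x => maxminor (lmx s *m G x)) eps lattice_minimal z ->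
  v != 0 -> exists l, eps / n.+2%:R <= `|(intmx v *m G z) 0 l|.
Proof.
move=> eps0 eps1 [F [F1 F2 F3]] v0; apply: contrapT => /forallNP small.
(* Among the members of the flag (and 0) not containing [v], take one of maximal
   rank, [V]; adjoining [v] to it gives a sublattice comparable to the flag,
   hence not small, although its covolume is at most that of [V] times |v|. *)
pose s00 : lattice := existT _ 0%N (0 : 'M[int]_(0, n.+1)).
pose vR : 'rV[R]_n.+1 := intmx v.
pose Q k := `[<exists s, [/\ F s \/ s = s00, ~ (vR <= lmx s)%MS & tag s = k]>].
have free s : F s \/ s = s00 -> row_free (lmx s).
  by move=> [/F1[[_ [fs _]] _]//|->]; rewrite /row_free (flatmx0 (lmx s00)) mxrank0.
have exQ : exists k, Q k.
  exists 0%N; apply/asboolP; exists s00; split => //; first by right.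
  rewrite (flatmx0 (lmx s00)) => /submx0null/matrixP h.
  move/eqP: v0; apply; apply/matrixP => i k; have := h i k.
  by rewrite !mxE => /eqP; rewrite intr_eq0 => /eqP.
have bQ k : Q k -> (k <= n.+1)%N.
  by move=> /asboolP[s [/free/eqP fs _ <-]]; rewrite -fs rank_leq_col.
case: (ex_maxnP exQ bQ) => j /asboolP[[j' V] [Fs vV /= jj']] jmax.
rewrite /lmx /= in vV; subst j'.
pose W : 'M[int]_(j.+1, n.+1) := col_mx v V.
have WE : intmx W = col_mx vR (intmx V).
  exact: (map_col_mx (fun k : int => k%:~R : R) v V).
have fV : row_free (intmx V : 'M[R]_(j, n.+1)) := free _ Fs.
have vW : (vR <= (intmx W : 'M[R]_(j.+1, n.+1)))%MS.
  have h : (vR <= col_mx vR (intmx V))%MS by rewrite -addsmxE addsmxSl.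
  by rewrite WE; exact: h.
have VW : (intmx V <= (intmx W : 'M[R]_(j.+1, n.+1)))%MS.
  have h : (intmx V <= col_mx vR (intmx V))%MS by rewrite -addsmxE addsmxSr.
  by rewrite WE; exact: h.
have WS k (M : 'M[R]_(k, n.+1)) : (vR <= M)%MS -> (intmx V <= M)%MS -> (intmx W <= M)%MS.
  move=> vM VM; have h : (col_mx vR (intmx V) <= M)%MS by rewrite col_mx_sub vM.
  by rewrite WE; exact: h.
have fW : row_free (intmx W : 'M[R]_(j.+1, n.+1)).
  rewrite /row_free eqn_leq rank_leq_row /=.
  have : (intmx V < (intmx W : 'M[R]_(j.+1, n.+1)))%MS.
    rewrite /ltmx VW; apply/negP => WV; apply: vV; exact: submx_trans vW WV.
  by move/rank_ltmx; rewrite (eqP fV).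
have jn : (j.+1 <= n.+1)%N by rewrite -(eqP fW) rank_leq_col.
have [W' minW' [A uA W'A]] := minimal_basis_exists fW.
have W'W : (intmx W' :=: (intmx W : 'M[R]_(j.+1, n.+1)))%MS.
  by rewrite W'A; apply: eqmxMfull; rewrite row_full_unit.
pose D : lattice := existT _ j.+1 W'.
have cmpD t : F t -> lattice_cmp D t.
  move=> Ft; rewrite /lattice_cmp /lmx /= !W'W.
  have Vt : lattice_cmp (existT _ j V) t.
    case: Fs => [/F2 h|->]; first exact: h.
    by left; rewrite (flatmx0 (lmx s00)) sub0mx.
  have [vt|vt] := pselect (vR <= lmx t)%MS.
    left; apply: WS => //; case: Vt => // tV.
    by case: vV; apply: submx_trans vt tV.
  (* A member of the flag without [v] has rank at most [j] by maximality, so if it contains [V] it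
     has the same span. *)
  right; apply: submx_trans VW; case: Vt => // Vt.
  have tj : (tag t <= j)%N by apply: jmax; apply/asboolP; exists t; split => //; left.
  suff /eqmxP-> : (lmx t == intmx V)%MS by [].
  rewrite andbC -(geq_leqif (mxrank_leqif_eq Vt)) /= (eqP fV).
  by rewrite (eqP (free t (or_introl Ft))).
(* If no member of the flag has rank j+1, then [D] is comparable to all of it with a new rank, and
   the last clause of [marked] applies. Otherwise the member of that rank has the same span as [W]
   and is at least [eps]. *)
have big : eps <= maxminor (intmx W *m G z).
  have [[t [Ft rt]]|nex] := pselect (exists t, F t /\ tag t = j.+1); last first.
    apply: le_trans eps1 _.
    apply: le_trans (maxminor_minimal _ minW' fW _); last by rewrite W'W.
    apply: (F3 D) => // t Ft; split; first exact: cmpD.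
    by move=> h; apply: nex; exists t.
  have [[_ minT] /andP[epsT _]] := F1 t Ft.
  apply: le_trans epsT _; have := cmpD t Ft; have ft := free t (or_introl Ft).
  case: t {Ft} rt minT ft => k Vt /= kj; subst k => minT ft.
  rewrite /lattice_cmp /lmx /= !W'W => cmpT.
  apply: maxminor_minimal => //.
  case: cmpT => // TW; rewrite /lmx /= in ft.
  suff /eqmxP-> : (intmx Vt == (intmx W : 'M[R]_(j.+1, n.+1)))%MS by [].
  by rewrite -(geq_leqif (mxrank_leqif_eq TW)) /= (eqP ft) (eqP fW).
have small' l : `|(vR *m G z) 0 l| <= eps / n.+2%:R.
  by rewrite ltW// ltNge; apply/negP; exact: small.
have V1 : maxminor (intmx V *m G z) <= 1.
  case: (Fs) => [/F1[_ /andP[_ /ltW]]//|].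
  move=> e; have j0 : j = 0%N by have := congr1 (@tag _ _) e.
  by clear -j0; subst j; rewrite maxminor0.
have e0 : 0 <= eps / n.+2%:R by rewrite divr_ge0// ltW.
have := maxminor_col_mx (intmx V *m G z) e0 small'.
rewrite -mul_col_mx -WE => /(le_trans big)/le_lt_trans h.
have : eps < eps; last by rewrite ltxx.
(* Here j+1 <= n+1 < n+2, whence the denominator n+2 in the threshold. *)
apply: h; apply: (@le_lt_trans _ _ (j.+1%:R * (eps / n.+2%:R))).
  by rewrite ler_piMr// mulr_ge0.
by rewrite mulrCA gtr_pMr// ltr_pdivrMr// mul1r ltr_nat.
Qed.

End ShortVectors.

(** * Minkowski for integer matrices *)

Section Minkowski.

(* The cosets of the row lattice of [N] number [|\det N|] (read off the Smith
   normal form), so two points of a box with more points are congruent. *)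
Lemma integer_minkowski (j H : nat) (N : 'M[int]_j) :
  \det N != 0 -> (absz (\det N) < H ^ j)%N ->
  exists2 a : 'rV[int]_j, a != 0 & forall i, (absz ((a *m N) ord0 i) < H)%N.
Proof.
move=> dN dH; have [L uL [Q uQ [d _ NE]]] := int_Smith_normal_form N.
set D := \matrix_(i, k) _ in NE.
pose dg (i : 'I_j) : int := d`_i.
have DE : D = diag_mx (\row_i dg i).
  by apply/matrixP => i k; rewrite !mxE.
have absU (M : 'M[int]_j) : M \in unitmx -> absz (\det M) = 1%N.
  by rewrite unitmxE => /orP[] /eqP ->.
have dprod : absz (\det N) = (\prod_(i < j) absz (dg i))%N.
  rewrite NE !det_mulmx !abszM (absU _ uL) (absU _ uQ) mul1n muln1 DE det_diag.
  rewrite (big_morph absz abszM (erefl _)).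
  by apply: eq_bigr => i _; rewrite mxE.
have d0 (i : 'I_j) : dg i != 0.
  apply: contra dN => /eqP di; rewrite -absz_eq0 dprod (bigD1 i)//= di.
  by rewrite mul0n.
pose kv (k : {ffun 'I_j -> 'I_H}) : 'rV[int]_j := \row_i (k i : nat)%:Z.
pose k' k := kv k *m invmx Q.
have lt_d k i : (absz (modz (k' k ord0 i) (dg i)) < absz (dg i))%N.
  have := ltz_mod (k' k ord0 i) (d0 i); have := modz_ge0 (k' k ord0 i) (d0 i).
  by lia.
pose cl k : {dffun forall i : 'I_j, 'I_(absz (dg i))} := [ffun i => Ordinal (lt_d k i)].
have [inj|] := pselect (injective cl).
  have := leq_card cl inj; rewrite card_ffun !card_ord.
  have -> : #|{dffun forall i : 'I_j, 'I_(absz (dg i))}| = absz (\det N).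
    rewrite card_dep_ffun dprod foldrE big_map enumT.
    by apply: eq_bigr => i _; rewrite card_ord.
  by rewrite leqNgt dH.
move=> /existsNP[k1 /existsNP[k2 /not_implyP[cl12 k12]]].
have subE (u w : 'rV[int]_j) i : (u - w) ord0 i = u ord0 i - w ord0 i.
  by rewrite !mxE.
have dv i : (dg i %| (k' k1 - k' k2) ord0 i)%Z.
  rewrite subE -eqz_mod_dvd; apply/eqP.
  have := congr1 (fun f : {dffun forall i : 'I_j, 'I_(absz (dg i))} => val (f i)) cl12.
  rewrite !ffunE /= => h.
  by rewrite -[LHS]gez0_abs ?modz_ge0// -[RHS]gez0_abs ?modz_ge0// h.
pose e : 'rV[int]_j := \row_i divz ((k' k1 - k' k2) ord0 i) (dg i).
have eD : e *m D = k' k1 - k' k2.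
  apply/rowP => i; rewrite DE mul_mx_diag mxE [in LHS]mxE [X in _ * X]mxE.
  by rewrite divzK.
have aN : e *m invmx L *m N = kv k1 - kv k2.
  rewrite NE !mulmxA mulmxKV// eD -mulmxBl mulmxKV//.
exists (e *m invmx L).
  apply: contra_not_neq k12 => a0; move: aN; rewrite a0 mul0mx => /esym/eqP.
  rewrite subr_eq0 => /eqP/rowP h; apply/ffunP => i; apply/val_inj.
  by have := h i; rewrite !mxE => -[].
move=> i; rewrite aN !mxE; have := ltn_ord (k1 i); have := ltn_ord (k2 i); lia.
Qed.

End Minkowski.

(** * Cramer's rule and the contractions c(w) *)

Section Cramer.
Context {R : comNzRingType}.

Definition upd (j m : nat) (c : 'I_j -> 'I_m) (i : 'I_j) (k : 'I_m) : 'I_j -> 'I_m :=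
  fun a => if a == i then k else c a.

(** Cramer's rule cleared of denominators: the coordinates of [a *m V] along the columns of [c]
    determine all the others, through the adjugate. *)
Lemma cramer_row j m (c : 'I_j -> 'I_m) (V : 'M[R]_(j, m)) (a : 'rV[R]_j) k :
  minor c V * (a *m V) ord0 k =
  \sum_i (a *m colsub c V) ord0 i * minor (upd c i k) V.
Proof.
set N := colsub c V.
have mE i : minor (upd c i k) V = (\adj N *m col k V) i ord0.
  rewrite /minor (expand_det_col _ i) mxE; apply: eq_bigr => r _.
  rewrite !mxE /upd eqxx mulrC; congr (_ * _); rewrite /cofactor; congr (_ * \det _).
  apply/matrixP => x y; rewrite !mxE; case: eqP => // h.
  by have := neq_lift i y; rewrite h eqxx.
have -> : \sum_i (a *m N) ord0 i * minor (upd c i k) V =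
    (a *m N *m (\adj N *m col k V)) ord0 ord0.
  by rewrite [RHS]mxE; apply: eq_bigr => i _; rewrite mE.
rewrite mulmxA -(mulmxA a) mul_mx_adj mul_mx_scalar -scalemxAl [RHS]mxE.
by congr (_ * _); rewrite !mxE; apply: eq_bigr => i _; rewrite mxE.
Qed.

End Cramer.

Section ReplacedMinors.
Context {R : realType} {m : nat}.

(** [J] is the set of the columns kept. Neither [J] nor the sign depends on [k], so a linear
    combination over [k] of replaced minors is, up to sign, one coordinate of the same combination
    of the c(w)_k. *)
Lemma minor_upd_cw j (V : 'M[R]_(j.+1, m.+1)) (c : 'I_j.+1 -> 'I_m.+1) (i : 'I_j.+1) :
  injective c -> (forall a, c a != ord0) ->
  exists (J : {set 'I_m.+1}) (b : bool), forall k,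
    minor (upd c i k) V = (-1) ^+ b * cw j.+1 (wcoord V) k J.
Proof.
move=> cinj c0.
have [] := injective_enum_perm (inj_comp cinj (@lift_inj _ i)).
set J := [set _ | _ in _]%SET => cJ [s hs].
have J0 : ord0 \notin J.
  by apply/negP => /imsetP[a _ /= /esym/eqP]; rewrite (negbTE (c0 _)).
exists J, (odd_perm (lift_perm i ord0 s)) => k.
rewrite cw_minor// -minor_perm; apply: eq_minor => a /=; rewrite /upd.
case: (unliftP i a) => [b ->|->]; last by rewrite lift_perm_id eqxx.
by rewrite lift_perm_lift eq_sym (negbTE (neq_lift _ _)) /= -hs.
Qed.

Lemma Rc_entry_le s (Rm : 'M[R]_(1 + s, 1 + m)) j (w : extvec) i J :
  `|\sum_k Rm i k * cw j w k J| <= Rc_norm Rm j w.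
Proof.
rewrite -sqrtr_sqr ler_wsqrtr// (bigD1 i)//= (bigD1 J)//= -addrA lerDl.
by apply: addr_ge0; repeat (apply: sumr_ge0 => ? _); exact: sqr_ge0.
Qed.

Lemma proj0_le_norm (w : {set 'I_m.+1} -> R) (I : {set 'I_m.+1}) : ord0 \notin I ->
  `|w I| <= ext_norm (proj0 w).
Proof.
move=> I0; rewrite -sqrtr_sqr ler_wsqrtr// (bigD1 I)//= {1}/proj0 (negbTE I0) lerDl.
by apply: sumr_ge0 => ? _; exact: sqr_ge0.
Qed.

(** Dimension of the exterior algebra, a crude constant between the Euclidean and the maximum
    norm. *)
Definition nsets : R := #|{set 'I_m.+1}|%:R.

Lemma ext_norm_le (w : {set 'I_m.+1} -> R) (d : R) : 0 <= d ->
  (forall I, `|w I| <= d) -> ext_norm w <= nsets * d.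
Proof.
move=> d0 h; have n0 : 0 <= nsets by rewrite ler0n.
rewrite -[leRHS]ger0_norm ?mulr_ge0// -sqrtr_sqr ler_wsqrtr//.
apply: (@le_trans _ _ (\sum_(I : {set 'I_m.+1}) d ^+ 2)).
  by apply: ler_sum => I _; rewrite -real_normK ?num_real// lerXn2r ?nnegrE.
rewrite sumr_const -[leLHS]mulr_natl exprMn ler_wpM2r ?sqr_ge0// expr2.
rewrite ler_peMl// ler1n; apply/card_gt0P; by exists finset.set0.
Qed.

End ReplacedMinors.

(** * From approximations at all scales to membership in W_u *)

Section SupNorm.
Context {R : realType} {n : nat}.
Implicit Types q : 'rV[int]_n.

Lemma le_supn q i : (`|q 0 i|)%:~R <= supn q :> R.
Proof. exact: le_bigmax. Qed.

Lemma supn_le q (Q : R) : 0 <= Q -> (forall i, (`|q 0 i|)%:~R <= Q) -> supn q <= Q.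
Proof. by move=> Q0 h; apply: bigmax_le. Qed.

Lemma supn_ge1 q : q != 0 -> 1 <= supn q :> R.
Proof.
move=> q0; apply: contrapT => h; move/eqP: q0; apply; apply/rowP => i; rewrite mxE.
apply/eqP; apply: contrapT => /negP qi; apply: h.
by apply: le_trans (le_supn q i); rewrite (ler_int _ 1) -gtz0_ge1 normr_gt0.
Qed.

Lemma nonint_gap (x : R) : (forall p : int, x + p%:~R != 0) ->
  exists2 e : R, 0 < e & forall p : int, e <= `|x + p%:~R|.
Proof.
move=> hx; set f := Num.floor x.
have fx : f%:~R <= x by rewrite real_floor_le ?num_real.
have xf : x < f%:~R + 1 by have := real_floorD1_gt (num_real x); rewrite intrD.
have fx' : f%:~R < x.
  rewrite lt_neqAle fx andbT; have := hx (- f).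
  by rewrite mulrNz subr_eq0 eq_sym.
exists (Num.min (x - f%:~R) (f%:~R + 1 - x)).
  by rewrite lt_min !subr_gt0 fx'.
move=> p; rewrite ge_min; have [pf|pf] := leP 0 (f + p).
  have : 0 <= (f + p)%:~R :> R by rewrite ler0z.
  rewrite intrD => h; apply/orP; left; rewrite ger0_norm; lra.
have : (f + p + 1)%:~R <= 0 :> R by rewrite lerz0; lia.
by rewrite !intrD => h; apply/orP; right; rewrite ltr0_norm; lra.
Qed.

(** Arbitrarily large [Q] might all be served by the same [q]. If y satisfies an exact integer
    relation, its multiples are infinitely many solutions. If not, finitely many [q] keep q . y at a
    positive distance from the integers, which a large [Q] contradicts. *)
Lemma Wset_of_approximations (u : R) (y : 'rV[R]_n) : 0 < u ->
  (forall Q0 : R, exists (Q : R) (q : 'rV[int]_n) (p : int),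
     [/\ Q0 <= Q, 1 <= Q, q != 0, supn q <= Q &
       `|\sum_i y 0 i * (q 0 i)%:~R + p%:~R| < Q `^ (- u)]) ->
  Wset u y.
Proof.
move=> u0 H finS; set S := [set q | _] in finS.
pose dot q : R := \sum_i y 0 i * (q 0 i)%:~R.
have [[q0 [q00 [p0 qp0]]]|nex] :=
    pselect (exists q0, q0 != 0 /\ exists p0 : int, dot q0 + p0%:~R = 0).
  apply: infinite_nat; pose h (k : nat) := q0 *+ k.+1.
  have hE k i : h k 0 i = q0 0 i * k.+1%:R by rewrite /h mulmxnE mulr_natr.
  have hinj : injective h.
    move=> k l e.
    have [i qi] : exists i, q0 0 i != 0.
      apply: contrapT => /forallNP ne; move/eqP: q00; apply; apply/rowP => i.
      by rewrite mxE; apply/eqP; apply: contrapT => /negP; exact: ne.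
    have := congr1 (fun w : 'rV[int]_n => w 0 i) e; rewrite /= !hE => /(mulfI qi)/eqP.
    by rewrite eqr_nat eqSS => /eqP.
  have -> : [set: nat] = h @^-1` S.
    apply/esym/seteqP; split => // k _.
    have hk0 : h k != 0.
      apply: contra q00 => /eqP/rowP e; apply/eqP/rowP => i.
      have := e i; rewrite hE !mxE => /eqP.
      by rewrite mulf_eq0 pnatr_eq0 orbF => /eqP.
    split => //; exists (p0 * k.+1%:R).
    have -> : \sum_i y 0 i * (h k 0 i)%:~R + (p0 * k.+1%:R)%:~R =
        (dot q0 + p0%:~R) * k.+1%:R.
      rewrite mulrDl intrM /= rmorph_nat; congr (_ + _).
      rewrite /dot mulr_suml; apply: eq_bigr => i _.
      by rewrite hE intrM rmorph_nat mulrA.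
    rewrite qp0 mul0r normr0 powR_gt0//; apply: lt_le_trans (supn_ge1 hk0); exact: ltr01.
  by apply: finite_preimage finS => ? ? _ _; exact: hinj.
have [d d0 hd] : exists2 d : R, 0 < d & forall q, S q -> forall p : int, d <= `|dot q + p%:~R|.
  have /finite_seqP[s Ss] := finS.
  have hs q : q \in s -> q != 0.
    by move=> qs; have [] : S q by rewrite Ss.
  rewrite Ss; elim: s {Ss} hs => [|q s IH] /= hs; first by exists 1.
  have [|d d0 hd] := IH; first by move=> q' q's; apply: hs; rewrite inE q's orbT.
  have [|e e0 he] := @nonint_gap (dot q).
    move=> p; apply/eqP => h; apply: nex; exists q; split; last by exists p.
    by apply: hs; rewrite mem_head.
  exists (Num.min d e); first by rewrite lt_min d0.
  move=> q' /=; rewrite inE => /orP[/eqP->|q's] p; rewrite ge_min.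
    by rewrite he orbT.
  by rewrite hd.
(* For Q >= d^(-1/u) the error bound Q^(-u) is at most [d]. *)
have [Q [q [p [Q0Q Q1 q0 qQ qp]]]] := H ((d^-1) `^ (u^-1)).
have Qpos : 0 < Q by apply: lt_le_trans Q1.
have qS : S q.
  split => //; exists p; apply: lt_le_trans qp _.
  rewrite !powRN lef_pV2 ?posrE ?powR_gt0//; last first.
    by apply: lt_le_trans (supn_ge1 q0).
  apply: ge0_ler_powR => //; rewrite ?nnegrE ?ltW//.
  by apply: lt_le_trans (supn_ge1 q0).
have := hd _ qS p; rewrite leNgt => /negP; apply; apply: lt_le_trans qp _.
rewrite powRN -[leRHS]invrK lef_pV2 ?posrE ?invr_gt0 ?powR_gt0//.
have -> : d^-1 = ((d^-1) `^ (u^-1)) `^ u.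
  by rewrite -powRrM mulVf ?gt_eqF// powRr1// invr_ge0 ltW.
by apply: ge0_ler_powR => //; rewrite ?nnegrE ?powR_ge0// ltW.
Qed.

End SupNorm.

(** * Failure of condition (iii) *)

Section SmallForms.
Context {R : realType} {n : nat}.

Lemma row_free_int_eq0 j (V : 'M[int]_(j, n.+1)) (a : 'rV[int]_j) :
  row_free (intmx V : 'M[R]_(j, n.+1)) -> a *m V = 0 -> a = 0.
Proof.
move=> fV aV; pose ar : 'rV[R]_j := map_mx (fun k : int => k%:~R) a.
have : ar *m intmx V = 0 by rewrite /ar /intmx -map_mxM aV map_mx0.
rewrite -(mul0mx 1 (intmx V)) => /(row_free_inj fV)/rowP h; apply/rowP => i.
by have := h i; rewrite !mxE => /eqP; rewrite intr_eq0 => /eqP.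
Qed.

(** Dominance over the other minors avoiding column 0 bounds the quotients in Cramer's rule by 1;
    comparability with |pi(w)| controls the determinant in Minkowski's theorem. *)
Lemma largest_minor j (V : 'M[int]_(j, n.+1)) :
  let P := ext_norm (proj0 (wcoord (intmx V : 'M[R]_(j, n.+1)))) in
  0 < P -> exists c : 'I_j -> 'I_n.+1,
    [/\ injective c, forall a, c a != ord0, minor c V != 0,
        (forall d : 'I_j -> 'I_n.+1, (forall a, d a != ord0) ->
          `|minor d (intmx V) : R| <= `|minor c (intmx V)|) &
        `|minor c (intmx V) : R| <= P <= nsets (R := R) (m := n) * `|minor c (intmx V)|].
Proof.
move=> P; set w := wcoord _ in P * => P0.
pose F (I : {set 'I_n.+1}) : R := `|proj0 w I|.
pose I0 := [arg max_(I > (finset.set0 : {set 'I_n.+1})) F I]%O.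
have I0max I : F I <= F I0.
  by rewrite /I0; case: arg_maxP => //= K _; exact.
have PF : P <= nsets (R := R) (m := n) * F I0.
  by apply: ext_norm_le => [|I]; [exact: normr_ge0|exact: I0max].
have F0 : 0 < F I0.
  rewrite lt_neqAle normr_ge0 andbT eq_sym. apply: contraTneq (P0) => e.
  by rewrite -leNgt (le_trans PF)// e mulr0.
have I00 : ord0 \notin I0.
  by apply: contraL (F0) => h; rewrite /F /proj0 h normr0 ltxx.
have FI : F I0 = `|w I0| by rewrite /F /proj0 (negbTE I00).
have cI : #|I0| = j.
  by apply/eqP; apply: contraLR (F0) => h; rewrite FI /w /wcoord (negbTE h) normr0 ltxx.
pose c (k : 'I_j) := nth ord0 (enum I0) k.
have wc : w I0 = minor c (intmx V) by rewrite /w wcoord_minor.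
exists c; split.
- exact: enum_nth_inj cI.
- move=> a; apply: contraNneq I00 => <-.
  by rewrite -mem_enum mem_nth// -cardE cI.
- by move: F0; rewrite FI wc minor_intmx normr_gt0 intr_eq0.
- move=> d d0; rewrite -wc -FI; have [dinj|] := pselect (injective d); last first.
    move=> /existsNP[a /existsNP[b /not_implyP[dab /eqP ab]]].
    by rewrite (minor_noninj _ ab dab) normr0 normr_ge0.
  rewrite normr_minor_wcoord// -/w; apply: le_trans (I0max _).
  rewrite /F /proj0 ifN//; apply/imsetP => -[a _ /esym/eqP].
  by rewrite (negbTE (d0 a)).
- by rewrite -wc -{2}FI PF andbT; apply: proj0_le_norm.
Qed.

(* With [c] a maximal minor, Cramer expresses all coordinates of a lattice
   vector through those in [c], which integer_minkowski makes small. *)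
Lemma small_linear_form j (V : 'M[int]_(j.+1, n.+1)) (h : 'I_n.+1 -> R) (E : R) :
  row_free (intmx V : 'M[R]_(j.+1, n.+1)) ->
  let w := wcoord (intmx V : 'M[R]_(j.+1, n.+1)) in
  let P := ext_norm (proj0 w) in
  0 < P ->
  (forall J, `|\sum_k h k * cw j.+1 w k J| <= E) ->
  exists x : 'rV[int]_n.+1,
    [/\ x != 0,
        forall l, l != ord0 -> `|(x ord0 l)%:~R : R| <= j.+1%:R * P `^ (j.+1%:R^-1) &
        `|\sum_k h k * (x ord0 k)%:~R| <=
           j.+1%:R * P `^ (j.+1%:R^-1) * (nsets (R := R) (m := n) * E / P)].
Proof.
move=> fV w P P0 hE; have [c [cinj c0 mc cmax /andP[cP Pc]]] := largest_minor P0.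
set d : R := `|_| in cP Pc.
have dE : d = (absz (minor c V))%:R by rewrite /d minor_intmx -intr_norm natr_absz.
have d0 : 0 < d by rewrite normr_gt0 minor_intmx intr_eq0.
set rho := P `^ _; have rho0 : 0 <= rho by exact: powR_ge0.
(* H > P^(1/(j+1)), so H^(j+1) exceeds the determinant, while an integer of absolute value below [H]
   is still at most [rho]. *)
pose H := (Num.truncn rho).+1.
have dH : (absz (\det (colsub c V)) < H ^ j.+1)%N.
  rewrite -(ltr_nat R) -dE natrX; apply: le_lt_trans cP _.
  rewrite (_ : ext_norm _ = rho ^+ j.+1); last first.
    by rewrite /rho -powR_mulrn ?powR_ge0// -powRrM mulVf// powRr1// ltW.
  by rewrite ltrXn2r// ?nnegrE// truncnS_gt.
have [a a0 aH] := integer_minkowski mc dH.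
have aN i : `|((a *m colsub c V) ord0 i)%:~R : R| <= rho.
  rewrite -intr_norm -natr_absz; apply: le_trans (_ : (Num.truncn rho)%:R <= _).
    by rewrite ler_nat -ltnS; exact: aH.
  by rewrite truncn_le.
exists (a *m V); split.
- by apply: contraNneq a0 => /(row_free_int_eq0 fV)->.
- move=> l l0; rewrite -(ler_pM2l d0) {1}/d minor_intmx -normrM -intrM cramer_row.
  rewrite rmorph_sum; apply: le_trans (ler_norm_sum _ _ _) _.
  apply: (@le_trans _ _ (\sum_(i < j.+1) rho * d)).
    apply: ler_sum => i _ /=; rewrite intrM normrM; apply: ler_pM => //.
    rewrite -minor_intmx; apply: cmax => b; rewrite /upd.
    by case: (b =P i) => // _; exact: c0.
  by rewrite sumr_const card_ord -[leLHS]mulr_natl mulrA mulrC.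
(* Applying the form [h] to Cramer's formula turns each replaced minor, up to sign, into a
   coordinate of the contraction bounded by [E]. *)
- rewrite -(ler_pM2l d0) {1}/d minor_intmx -normrM mulr_sumr.
  have -> : \sum_k (minor c V)%:~R * (h k * ((a *m V) ord0 k)%:~R) =
    \sum_i ((a *m colsub c V) ord0 i)%:~R *
       \sum_k h k * minor (upd c i k) (intmx V : 'M[R]_(j.+1, n.+1)).
    transitivity (\sum_k \sum_i ((a *m colsub c V) ord0 i)%:~R *
        (h k * minor (upd c i k) (intmx V : 'M[R]_(j.+1, n.+1)))).
      apply: eq_bigr => k _; rewrite mulrCA -intrM cramer_row rmorph_sum mulr_sumr.
      by apply: eq_bigr => i _; rewrite /= intrM minor_intmx mulrCA.
    by rewrite exchange_big; apply: eq_bigr => i _; rewrite mulr_sumr.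
  apply: le_trans (ler_norm_sum _ _ _) _.
  apply: (@le_trans _ _ (\sum_(i < j.+1) rho * E)).
    apply: ler_sum => i _ /=; rewrite normrM; apply: ler_pM => //.
    have [J [b hJ]] := minor_upd_cw (intmx V : 'M[R]_(j.+1, n.+1)) i cinj c0.
    under eq_bigr => k _ do rewrite hJ mulrCA.
    by rewrite -mulr_sumr normrM normrX normrN1 expr1n mul1r.
  rewrite sumr_const card_ord -[leLHS]mulr_natl.
  have E0 : 0 <= E by apply: le_trans (hE finset.set0).
  have -> : d * (j.+1%:R * rho * (nsets (R := R) (m := n) * E / P)) =
      j.+1%:R * (rho * E) * (nsets (R := R) (m := n) * d / P) by ring.
  rewrite ler_peMr ?mulr_ge0//; by rewrite ler_pdivlMr// mul1r.
Qed.

End SmallForms.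

Section FailureOfCondition.
Context {R : realType} {n : nat}.

Lemma powR_unbounded (t C : R) : 0 < t -> exists2 M : R, 0 < M &
  forall P, M < P -> C < P `^ t.
Proof.
move=> t0; pose D := Num.max C 1.
have D0 : 0 < D by rewrite lt_max ltr01 orbT.
exists (D `^ t^-1); first exact: powR_gt0.
move=> P MP; apply: (@le_lt_trans _ _ D); first by rewrite le_max lexx.
have -> : D = (D `^ t^-1) `^ t by rewrite -powRrM mulVf ?gt_eqF// powRr1// ltW.
apply: gt0_ltr_powR => //; rewrite ?nnegrE ?powR_ge0//.
by apply: le_trans (ltW MP); rewrite powR_ge0.
Qed.

Lemma not_cond_iii_Wset (s : nat) (v : R) (L : set 'rV[R]_n)
    (Rm : 'M[R]_(1 + s, 1 + n)) : 0 <= v -> admissible L Rm -> ~ cond_iii v Rm ->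
  exists2 u : R, v < u & forall y, L y -> Wset u y.
Proof.
move=> v0 [h [_ _ hsurj _ hR]] /existsNP[[|j]].
  by move=> /not_implyP[].
move=> /not_implyP[/andP[_ jn]] /existsNP[u /not_implyP[uv nM]].
set J : R := j.+1%:R; have J0 : 0 < J by rewrite ltr0n.
have uv' : v + 1 - J < J * u by move: uv; rewrite ltr_pdivrMr// [u * _]mulrC.
(* With P = |pi(w)|, Minkowski gives |q| of order P^(1/J) and a form of order P^(1/J - 1 - u) =
   (P^(1/J))^(-t). The midpoint [u'] leaves room for the constants. *)
pose t := J * (1 + u) - 1; have vt : v < t by rewrite /t; lra.
pose u' := (v + t) / 2; have vu' : v < u' by rewrite /u'; lra.
have u'0 : 0 < u' by apply: le_lt_trans vu'.
exists u' => // y Ly; have [z hz] := hsurj y Ly.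
apply: Wset_of_approximations => // Q0.
pose hom k : R := (homog y) 0 k.
pose Cy : R := \sum_i `|row_mx (const_mx 1 : 'rV[R]_1) z 0 i|.
have Cy0 : 0 <= Cy by apply: sumr_ge0.
pose nn := nsets (R := R) (m := n).
have nn0 : 0 <= nn by rewrite ler0n.
pose C := Num.max 1 (J * (1 + nn * Cy)).
have C1 : 1 <= C by rewrite le_max lexx.
have C0 : 0 < C by apply: lt_le_trans C1.
pose a := J^-1; have a0 : 0 < a by rewrite invr_gt0.
(* [th] equals (t - u')/J, the power of P left over to absorb [C]. *)
pose th := 1 + u - a * (1 + u').
have th0 : 0 < th.
  rewrite /th subr_gt0 /a mulrC ltr_pdivrMr//; rewrite /u' /t; move: vt; rewrite /t.
  by lra.
have [M1 M10 hM1] := powR_unbounded (C `^ (1 + u')) th0.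
have [M2 M20 hM2] := powR_unbounded Q0 a0.
pose M := Num.max 1 (Num.max M1 M2).
have M0 : 0 < M by rewrite lt_max ltr01.
have [V [fV w MP RcP]] : exists V : 'M[int]_(j.+1, n.+1),
   let w := wcoord (intmx V : 'M[R]_(j.+1, n.+1)) in
   [/\ row_free (intmx (R := R) V), True, M < ext_norm (proj0 w) &
     Rc_norm Rm j.+1 w <= ext_norm (proj0 w) `^ (- u)].
  apply: contrapT => /forallNP hV; apply: nM; exists M => // V fV w MP.
  by rewrite ltNge; apply/negP => le; apply: (hV V).
clear w; set w := wcoord _ in MP RcP; set P := ext_norm _ in MP RcP.
have P0 : 0 < P by apply: lt_trans MP.
have P1 : 1 < P by apply: le_lt_trans MP; rewrite le_max lexx.
(* Since (1, y) = (1, z) R, contracting with (1, y) combines the components of Rc(w) with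
   coefficients (1, z). *)
have hE J' : `|\sum_k hom k * cw j.+1 w k J'| <= Cy * P `^ (- u).
  have -> : \sum_k hom k * cw j.+1 w k J' =
    \sum_i row_mx (const_mx 1 : 'rV[R]_1) z 0 i * \sum_k Rm i k * cw j.+1 w k J'.
    transitivity (\sum_k \sum_i row_mx (const_mx 1 : 'rV[R]_1) z 0 i * (Rm i k * cw j.+1 w k J')).
      apply: eq_bigr => k _; rewrite /hom /homog -hz hR mxE mulr_suml.
      by apply: eq_bigr => i _; rewrite mulrA.
    by rewrite exchange_big; apply: eq_bigr => i _; rewrite mulr_sumr.
  apply: le_trans (ler_norm_sum _ _ _) _; rewrite /Cy mulr_suml.
  apply: ler_sum => i _; rewrite normrM ler_wpM2l//.
  by apply: le_trans RcP; exact: Rc_entry_le.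
have [x [x0 xq xp]] := small_linear_form fV P0 hE.
rewrite -/P -/J -/a in xq xp.
have Pa0 : 0 < P `^ a by exact: powR_gt0.
pose Q := C * P `^ a.
have Pa1 : 1 <= P `^ a by rewrite -(powRr0 P) ler_powR// ltW.
have JC : J <= C.
  rewrite le_max; apply/orP; right; apply: ler_peMr; first exact: ltW.
  by rewrite lerDl mulr_ge0.
have JCy : J * (nn * Cy) <= C.
  by rewrite le_max; apply/orP; right; rewrite ler_pM2l// lerDr.
have Q1 : 1 <= Q by rewrite mulr_ege1.
have QQ0 : Q0 <= Q.
  apply: (@le_trans _ _ (P `^ a)); last by rewrite ler_peMl// ltW.
  by apply/ltW/hM2; apply: le_lt_trans MP; rewrite !le_max lexx !orbT.
pose q : 'rV[int]_n := \row_i x ord0 (lift ord0 i).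
have dotE : \sum_k hom k * (x ord0 k)%:~R =
    \sum_i y 0 i * (q 0 i)%:~R + (x ord0 ord0)%:~R.
  rewrite big_ord_recl /hom homog0 mul1r addrC; congr (_ + _).
  by apply: eq_bigr => i _; rewrite homog_lift mxE.
have nz (b : R) : b != 0 -> forall e f : R, (e + f == 0) ==> (b != 0).
  by move=> -> e f; rewrite implybT.
have xQ : `|\sum_k hom k * (x ord0 k)%:~R| < Q `^ (- u').
  apply: le_lt_trans xp _.
  apply: (@le_lt_trans _ _ (C * P `^ (a - 1 - u))).
    rewrite !powRD ?nz ?(gt_eqF P0)//.
    rewrite (powRN P 1) powRr1 ?(ltW P0)//.
    have -> : J * P `^ a * (nn * (Cy * P `^ (- u)) / P) =
      J * (nn * Cy) * (P `^ a * P^-1 * P `^ (- u)) by ring.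
    by rewrite ler_wpM2r// !mulr_ge0 ?powR_ge0// invr_ge0 ltW.
  rewrite /Q powRM ?powR_ge0 ?ltW// -powRrM.
  have M1P : M1 < P by apply: le_lt_trans MP; rewrite !le_max lexx !orbT.
  have -> : C * P `^ (a - 1 - u) =
      C `^ (- u') * P `^ (a * - u') * (C `^ (1 + u') / P `^ th).
    rewrite -powRN mulrACA -!powRD ?nz ?gt_eqF//.
    by congr (_ * _ `^ _); [rewrite addrCA addNr addr0 powRr1// ltW|rewrite /th; ring].
  by rewrite gtr_pMr ?mulr_gt0 ?powR_gt0// ltr_pdivrMr ?powR_gt0// mul1r hM1.
exists Q, q, (x ord0 ord0); split => //.
(* If [q] were 0, the form would be a nonzero integer, too large for the bound Q^(-u') <= 1. *)
- apply: contraNneq x0 => q0; apply/eqP/rowP => k; rewrite mxE.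
  have qk i : x ord0 (lift ord0 i) = 0.
    by have := congr1 (fun r : 'rV[int]_n => r 0 i) q0; rewrite !mxE.
  case: (unliftP ord0 k) => [i ->//|->]; apply/eqP.
  apply: contraLR xQ => xn0; rewrite dotE big1 ?add0r => [|i _]; last first.
    by rewrite mxE qk mulr0.
  rewrite -leNgt; apply: (@le_trans _ _ 1); last by apply: intr_norm_ge1; rewrite intr_eq0.
  by rewrite -(powRr0 Q) ler_powR// oppr_le0 ltW.
- apply: supn_le => [|i]; first by rewrite mulr_ge0// ltW.
  rewrite mxE intr_norm; apply: le_trans (xq _ _) _.
    by rewrite eq_sym neq_lift.
  by rewrite ler_wpM2r// ltW.
- by rewrite -dotE.
Qed.

End FailureOfCondition.

(** * Lower bounds from condition (iii) *)

Section UniformCondition.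
Context {R : realType} {n : nat}.

Lemma scale_first_row j (m : nat) (V : 'M[int]_(j.+1, n.+1)) : (0 < m)%N ->
  row_free (intmx V : 'M[R]_(j.+1, n.+1)) ->
  exists V' : 'M[int]_(j.+1, n.+1), row_free (intmx V' : 'M[R]_(j.+1, n.+1)) /\
    wcoord (intmx V' : 'M[R]_(j.+1, n.+1)) =
    (fun I => m%:R * wcoord (intmx V : 'M[R]_(j.+1, n.+1)) I).
Proof.
move=> m0 fV; pose d : 'rV[R]_j.+1 := \row_i (if i == ord0 then m%:R else 1).
have dd : \det (diag_mx d) = m%:R.
  rewrite det_diag big_ord_recl !mxE eqxx big1 ?mulr1// => i _.
  by rewrite mxE eq_sym (negbTE (neq_lift _ _)).
pose V' : 'M[int]_(j.+1, n.+1) := \matrix_(i, k) ((if i == ord0 then m%:R else 1) * V i k).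
have V'E : intmx V' = diag_mx d *m intmx V :> 'M[R]_(j.+1, n.+1).
  apply/matrixP => i k; rewrite mul_diag_mx !mxE.
  by case: eqP => _; rewrite intrM ?mul1r// rmorph_nat.
have ud : diag_mx d \in unitmx by rewrite unitmxE dd unitfE pnatr_eq0 -lt0n.
exists V'; split.
  by rewrite V'E /row_free mxrankMfree ?mxrank_unit.
apply/funext => I; rewrite V'E.
have [cI|cI] := eqVneq #|I| j.+1; last by rewrite /wcoord (negbTE cI) mulr0.
by rewrite !wcoord_minor// minor_mulmx dd.
Qed.

Lemma ext_normZ (a : R) (w : {set 'I_n.+1} -> R) : 0 <= a ->
  ext_norm (fun I => a * w I) = a * ext_norm w.
Proof.
move=> a0; rewrite /ext_norm -[X in X * _]ger0_norm// -sqrtr_sqr -sqrtrM ?sqr_ge0//.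
by congr Num.sqrt; rewrite mulr_sumr; apply: eq_bigr => I _; rewrite exprMn.
Qed.

Lemma Rc_normZ s (Rm : 'M[R]_(1 + s, 1 + n)) j (a : R) (w : {set 'I_n.+1} -> R) :
  0 <= a -> Rc_norm Rm j (fun I => a * w I) = a * Rc_norm Rm j w.
Proof.
move=> a0; rewrite /Rc_norm -[X in X * _]ger0_norm// -sqrtr_sqr -sqrtrM ?sqr_ge0//.
congr Num.sqrt; rewrite mulr_sumr; apply: eq_bigr => i _.
rewrite mulr_sumr; apply: eq_bigr => J _; rewrite -exprMn; congr (_ ^+ _).
rewrite mulr_sumr; apply: eq_bigr => k _; rewrite mulrCA; congr (_ * _).
rewrite /cw; case: ifP => _; last by rewrite mulr0.
by rewrite /ext_dot mulr_sumr; apply: eq_bigr => I _; rewrite mulrCA.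
Qed.

Lemma Rc_norm_le s (Rm : 'M[R]_(1 + s, 1 + n)) j (w : {set 'I_n.+1} -> R) (d : R) :
  0 <= d -> (forall i J, `|\sum_k Rm i k * cw j w k J| <= d) ->
  Rc_norm Rm j w <= (1 + s)%:R * nsets (R := R) (m := n) * d.
Proof.
move=> d0 h; have n0 : 0 <= nsets (R := R) (m := n) by rewrite ler0n.
have n1 : 1 <= nsets (R := R) (m := n).
  by rewrite ler1n; apply/card_gt0P; exists finset.set0.
rewrite -[leRHS]ger0_norm ?mulr_ge0// -sqrtr_sqr ler_wsqrtr//.
apply: (@le_trans _ _ (\sum_(i : 'I_(1 + s)) \sum_(J : {set 'I_n.+1}) d ^+ 2)).
  apply: ler_sum => i _; apply: ler_sum => J _.
  by rewrite -real_normK ?num_real// lerXn2r ?nnegrE.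
rewrite !sumr_const card_ord -![leLHS]mulr_natl -[X in _ * X <= _]mulr_natl mulrA -/nsets.
rewrite exprMn ler_wpM2r ?sqr_ge0// expr2.
by rewrite ler_peMl ?mulr_ge0// mulr_ege1// ler1n.
Qed.

Lemma proj0_norm_ge1 j (V : 'M[int]_(j, n.+1)) :
  let P := ext_norm (proj0 (wcoord (intmx V : 'M[R]_(j, n.+1)))) in 0 < P -> 1 <= P.
Proof.
move=> P P0; have [c [_ _ mc _ /andP[cP _]]] := largest_minor P0.
by apply: le_trans cP; apply: minor_intmx_ge1; rewrite minor_intmx intr_eq0.
Qed.

(** When pi(w) = 0, every nonzero coordinate of [w] involves e_0. Deleting 0 from the index set of
    one of them gives a [J] at which c(w)_k vanishes for all k other than 0, and the first component
    of Rc(w) there is a nonzero integer. *)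
Lemma Rc_norm_vertical s (Rm : 'M[R]_(1 + s, 1 + n)) j (V : 'M[int]_(j.+1, n.+1)) :
  (forall i, Rm i ord0 = (i == ord0)%:R) ->
  row_free (intmx V : 'M[R]_(j.+1, n.+1)) ->
  let w := wcoord (intmx V : 'M[R]_(j.+1, n.+1)) in
  ext_norm (proj0 w) <= 0 -> 1 <= Rc_norm Rm j.+1 w.
Proof.
move=> R0 fV w P0; have [c mc] := row_free_minor fV.
have cinj : injective c.
  apply: contrapT => /existsNP[a /existsNP[b /not_implyP[dab /eqP ab]]].
  by move/eqP: mc; apply; exact: minor_noninj ab dab.
have w0 (I : {set 'I_n.+1}) : ord0 \notin I -> w I = 0.
  by move=> I0; apply/eqP; rewrite -normr_le0 (le_trans (proj0_le_norm w I0)).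
pose I : {set 'I_n.+1} := [set c a | a in 'I_j.+1]%SET.
have cI : #|I| = j.+1 by have [] := injective_enum_perm cinj.
have wI : 1 <= `|w I| by rewrite -normr_minor_wcoord//; exact: minor_intmx_ge1.
have I0 : ord0 \in I.
  by apply: contraLR wI => /w0 ->; rewrite normr0 -ltNge ltr01.
pose J := (I :\ ord0)%SET.
have J0 : ord0 \notin J by rewrite !inE eqxx.
have cJ : #|J| = j by have := cardsD1 ord0 I; rewrite I0 cI => -[].
have cwk k : k != ord0 -> cw j.+1 w k J = 0.
  move=> k0; rewrite cw_minor//; set d := (fun a => _ : 'I_n.+1).
  have [dinj|] := pselect (injective d); last first.
    move=> /existsNP[a /existsNP[b /not_implyP[dab /eqP ab]]].
    exact: minor_noninj ab dab.
  apply/eqP; rewrite -normr_eq0 normr_minor_wcoord// normr_eq0 -/w; apply/eqP/w0.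
  apply/imsetP => -[[[|a] /= ha] _ /esym/eqP]; rewrite /d /= ?(negbTE k0)//.
  apply/negP; apply: contraNneq J0 => <-.
  by rewrite -mem_enum mem_nth// -cardE cJ.
apply: le_trans (Rc_entry_le Rm j.+1 w ord0 J).
rewrite (bigD1 ord0)//= R0 eqxx mul1r big1 ?addr0; last first.
  by move=> k k0; rewrite cwk ?mulr0.
rewrite cw_minor//; set d := (fun a => _ : 'I_n.+1).
have us : uniq (ord0 :: enum J) by rewrite /= mem_enum J0 enum_uniq.
have ss : size (ord0 :: enum J) = j.+1 by rewrite /= -cardE cJ.
have dinj : injective d.
  by move=> a b /eqP; rewrite nth_uniq ?ss// => /eqP/val_inj.
rewrite normr_minor_wcoord// -/w.
suff -> : [set d a | a in 'I_j.+1]%SET = I by [].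
apply/eqP; rewrite eqEcard cI (card_imset _ dinj) card_ord leqnn andbT.
apply/fintype.subsetP => _ /imsetP[a _ ->].
have : d a \in ord0 :: enum J by rewrite mem_nth// ss.
by rewrite inE mem_enum => /orP[/eqP->//|]; rewrite inE => /andP[].
Qed.

(* Condition (iii) only speaks of large [pi(w)]; integer multiples of [w] reduce
   the other [w] to that case, except when [pi(w) = 0], where [c(w)_0] is a
   nonzero integer vector. *)
Lemma cond_iii_uniform (s : nat) (v : R) (Rm : 'M[R]_(1 + s, 1 + n)) j (u : R) :
  (forall i, Rm i ord0 = (i == ord0)%:R) ->
  cond_iii v Rm -> (j.+1 <= n)%N -> (v + 1 - j.+1%:R) / j.+1%:R < u -> 0 <= u ->
  exists2 k : R, 0 < k & forall V : 'M[int]_(j.+1, n.+1),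
    row_free (intmx V : 'M[R]_(j.+1, n.+1)) ->
    let w := wcoord (intmx V : 'M[R]_(j.+1, n.+1)) in
    k * Num.max 1 (ext_norm (proj0 w)) `^ (- u) <= Rc_norm Rm j.+1 w.
Proof.
move=> R0 H jn uv u0; have [M M0 hM] := H j.+1 jn u uv.
pose m := (Num.truncn M).+1; have Mm : M < m%:R by exact: truncnS_gt.
have m0 : 0 < m%:R :> R by rewrite ltr0n.
(* The bound for m w at the largest remaining value |pi(w)| = M, divided by [m]. *)
pose k2 := m%:R^-1 * (m%:R * M) `^ (- u).
have k20 : 0 < k2 by rewrite mulr_gt0 ?invr_gt0 ?powR_gt0// mulr_gt0.
pose k := Num.min 1 k2; have k0 : 0 < k by rewrite lt_min ltr01.
exists k => // V fV /=; set w := wcoord _; set P := ext_norm (proj0 w).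
have [P0|P0] := leP P 0.
  apply: le_trans (Rc_norm_vertical R0 fV P0).
  rewrite (max_idPl _) ?(le_trans P0)// powR1 mulr1 ge_min lexx//.
have P1 : 1 <= P by exact: proj0_norm_ge1.
rewrite (max_idPr P1); have [PM|MP] := leP P M; last first.
  apply: le_trans (ltW (hM V fV MP)).
  by rewrite ler_piMl ?powR_ge0// ge_min lexx.
have [V' [fV' wV']] := @scale_first_row j m V isT fV.
have := hM V' fV'; rewrite /= wV' (Rc_normZ _ _ _ (ltW m0)).
have -> : proj0 (fun I => m%:R * wcoord (intmx V : 'M[R]_(j.+1, n.+1)) I) =
    (fun I => m%:R * proj0 w I).
  by apply/funext => I; rewrite /proj0; case: ifP => //; rewrite mulr0.
rewrite (ext_normZ _ (ltW m0)) -/P -/w => /(_ _)/ltW h.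
apply: (@le_trans _ _ k2).
  apply: (@le_trans _ _ k); last by rewrite ge_min lexx orbT.
  rewrite (ler_piMr (ltW k0))// -(powRr0 P) ler_powR// oppr_le0//.
rewrite -(ler_pM2l m0) mulrA divff ?gt_eqF// mul1r; apply: le_trans (h _); last first.
  by apply: lt_le_trans Mm _; rewrite ler_peMr// ltW.
have mP0 : 0 < m%:R * P by rewrite mulr_gt0.
rewrite !powRN lef_pV2 ?posrE ?powR_gt0// ?mulr_gt0//.
apply: ge0_ler_powR => //; rewrite ?nnegrE; [exact: ltW| |by rewrite ler_pM2l].
by rewrite mulr_ge0// ltW.
Qed.

End UniformCondition.

Section SpanningPoints.
Context {R : realType} {n : nat} {X : Type}.

Lemma spanning_points (f : X -> 'rV[R]_n) (Q : set X) :
  exists (m : nat) (p : 'I_m -> X), (forall a, Q (p a)) /\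
    forall z, Q z -> (homog (f z) <= \matrix_(a < m) homog (f (p a)))%MS.
Proof.
pose Pr k := `[<exists (m : nat) (p : 'I_m -> X), (forall a, Q (p a)) /\
  \rank (\matrix_(a < m) homog (f (p a))) = k>].
have exP : exists k, Pr k.
  exists 0%N; apply/asboolP; exists 0%N, (fun i : 'I_0 => False_rect X (notF (ltn_ord i))).
  by split => [[]//|]; rewrite flatmx0 mxrank0.
have bP k : Pr k -> (k <= n.+1)%N.
  by move=> /asboolP[m [p [_ <-]]]; rewrite rank_leq_col.
case: (ex_maxnP exP bP) => k /asboolP[m [p [Qp rp]]] kmax.
exists m, p; split => // z Qz; set Y := \matrix_a _ in rp *.
pose p' (a : 'I_m.+1) := if unlift ord0 a is Some b then p b else z.
pose Y' := \matrix_(a < m.+1) homog (f (p' a)).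
have zY' : (homog (f z) <= Y')%MS.
  have := row_sub ord0 Y'; rewrite rowK /p' unlift_none.
  exact.
have YY' : (Y <= Y')%MS.
  apply/row_subP => a; have := row_sub (lift ord0 a) Y'.
  by rewrite !rowK /p' liftK.
apply: submx_trans zY' _.
suff /eqmxP-> : (Y == Y')%MS by [].
rewrite -(geq_leqif (mxrank_leqif_eq YY')) /= rp; apply: kmax; apply/asboolP.
exists m.+1, p'; split => // a; rewrite /p'; by case: unlift.
Qed.

Lemma aff_span_homog_sub (f : X -> 'rV[R]_n) (Q : set X) m (Y : 'M[R]_(m, n.+1)) y :
  (forall z, Q z -> (homog (f z) <= Y)%MS) -> aff_span (f @` Q) y ->
  (homog y <= Y)%MS.
Proof.
move=> QY [k [lam [p [Qp lam1 ->]]]].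
have -> : homog (\sum_k0 lam k0 *: p k0) = \sum_k0 lam k0 *: homog (p k0).
  apply/rowP => l; rewrite summxE; case: (unliftP ord0 l) => [i ->|->].
    rewrite homog_lift summxE; apply: eq_bigr => a _.
    by rewrite [LHS]mxE [RHS]mxE homog_lift.
  rewrite homog0 -lam1; apply: eq_bigr => a _.
  by rewrite [RHS]mxE homog0 mulr1.
apply: summx_sub => a _; apply: scalemx_sub.
by have [z Qz <-] := Qp a; exact: QY.
Qed.

(** The first row of [Rm] is (1, h(0)) and the others are differences (1, h(e_k)) - (1, h(0)). *)
Lemma admissible_sub (s : nat) (L : set 'rV[R]_n) (Rm : 'M[R]_(1 + s, 1 + n))
    m (Y : 'M[R]_(m, n.+1)) :
  admissible L Rm -> (forall y, L y -> (homog y <= Y)%MS) -> ((Rm : 'M[R]_(1 + s, n.+1)) <= Y)%MS.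
Proof.
move=> [h [_ hL _ _ hR]] LY.
pose Ru : 'rV[R]_n.+1 := @usubmx R 1 s n.+1 Rm.
pose Rd : 'M[R]_(s, n.+1) := @dsubmx R 1 s n.+1 Rm.
have RE : (Rm : 'M[R]_(1 + s, n.+1)) = col_mx Ru Rd by rewrite vsubmxK.
have one : const_mx 1 = 1%:M :> 'M[R]_1.
  by apply/matrixP => i j; rewrite !mxE !ord1.
have sub (x : 'rV[R]_s) : ((Ru + x *m Rd)%R <= Y)%MS.
  have := LY _ (hL x); rewrite /homog hR RE mul_row_col one mul1mx. exact.
have sub0 : (Ru <= Y)%MS by have := sub 0; rewrite mul0mx addr0.
rewrite RE col_mx_sub sub0 /=; apply/row_subP => k; rewrite rowE.
by rewrite -[_ *m _](addKr Ru) addmx_sub// eqmx_opp.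
Qed.

End SpanningPoints.

(** * Lower bounds for flowed multivectors *)

Section CovolumeBound.
Context {R : realType} {n : nat}.

Lemma admissible_col0 (s : nat) (L : set 'rV[R]_n) (Rm : 'M[R]_(1 + s, 1 + n)) :
  admissible L Rm -> forall i, Rm i ord0 = (i == ord0)%:R.
Proof.
move=> [h [_ _ _ _ hR]].
have e x : \sum_i row_mx (const_mx 1 : 'rV[R]_1) x 0 i * Rm i ord0 = 1.
  have := congr1 (fun M : 'rV[R]_(1 + n) => M 0 ord0) (hR x).
  by rewrite /= [in RHS]mxE => <-; exact: homog0.
have e0 : Rm ord0 ord0 = 1.
  rewrite -(e 0) big_split_ord big_ord1 /= [X in _ + X]big1 ?addr0.
    by rewrite row_mxEl mxE mul1r; congr (Rm _ _); apply: val_inj.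
  by move=> i _; rewrite row_mxEr mxE mul0r.
move=> i; case: (fintype.splitP i) => k ik.
  have -> : i = ord0 by apply: val_inj; rewrite /= ik ord1.
  by rewrite eqxx.
have ik' : i = rshift 1 k by apply: val_inj.
have := e (delta_mx 0 k); rewrite big_split_ord big_ord1 /= (bigD1 k)//=.
rewrite row_mxEl mxE mul1r (_ : lshift s 0 = ord0) ?e0; last exact: val_inj.
rewrite big1 ?addr0 => [|l lk]; last first.
  by rewrite row_mxEr mxE (negbTE lk) andbF mul0r.
rewrite row_mxEr mxE !eqxx mul1r -ik' => h1.
have -> : Rm i ord0 = 0 by move: h1; lra.
by rewrite ik' [_ == _](_ : _ = false)//; apply/eqP => /(congr1 val).
Qed.

(** [Rm] factors as [T *m Y], the rows of [Y] being homogenised values of [f] at finitely many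
    points of [Q]. One of these points must carry a proportional part of the value, with a constant
    depending only on [T]. *)
Lemma nonplanar_functional (X : Type) (f : X -> 'rV[R]_n) (Q : set X) (s : nat)
    (L : set 'rV[R]_n) (Rm : 'M[R]_(1 + s, 1 + n)) :
  admissible L Rm -> Q !=set0 -> aff_span (f @` Q) = L ->
  exists2 k : R, 0 < k & forall (c : 'I_n.+1 -> R) i, exists2 z, Q z &
    k * `|\sum_l Rm i l * c l| <= `|\sum_l homog (f z) 0 l * c l|.
Proof.
move=> adm [z0 Qz0] QL; have [m [p [Qp pQ]]] := spanning_points f Q.
set Y := \matrix_a _ in pQ.
have RY : ((Rm : 'M[R]_(1 + s, n.+1)) <= Y)%MS.
  apply: admissible_sub adm _ => y; rewrite -QL; exact: aff_span_homog_sub.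
pose T := (Rm : 'M[R]_(1 + s, n.+1)) *m pinvmx Y.
have RE : T *m Y = Rm by rewrite mulmxKpV.
pose t : R := 1 + \sum_i \sum_a `|T i a|.
have t0 : 0 < t by rewrite ltr_pwDl// !sumr_ge0// => i _; exact: sumr_ge0.
exists t^-1; first by rewrite invr_gt0.
move=> c i; set x := \sum_l _; apply: contrapT => nex.
have small z : Q z -> `|\sum_l homog (f z) 0 l * c l| < t^-1 * `|x|.
  by move=> Qz; rewrite ltNge; apply/negP => h; apply: nex; exists z.
have x0 : 0 < `|x|.
  have := le_lt_trans (normr_ge0 _) (small z0 Qz0).
  by rewrite pmulr_rgt0 ?invr_gt0.
have : `|x| < `|x|; last by rewrite ltxx.
have xE : x = \sum_a T i a * \sum_l homog (f (p a)) 0 l * c l.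
  rewrite /x -RE.
  transitivity (\sum_l \sum_a T i a * (homog (f (p a)) 0 l * c l)).
    apply: eq_bigr => l _; rewrite mxE mulr_suml; apply: eq_bigr => a _.
    by rewrite [Y a l]mxE mulrA.
  by rewrite exchange_big; apply: eq_bigr => a _; rewrite mulr_sumr.
rewrite {1}xE; apply: le_lt_trans (ler_norm_sum _ _ _) _.
apply: (@le_lt_trans _ _ (\sum_a `|T i a| * (t^-1 * `|x|))).
  by apply: ler_sum => a _; rewrite normrM ler_wpM2l// ltW// small.
rewrite -mulr_suml mulrA gtr_pMl// ltr_pdivrMr// mul1r /t (bigD1 i)//=.
rewrite addrCA ltrDl ltr_pwDl// sumr_ge0// => k _; exact: sumr_ge0.
Qed.

Lemma det_flow A B (y : 'rV[R]_n) : \det (flow A B y) = A * B ^- n.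
Proof.
rewrite det_trig.
  rewrite big_ord_recl mxE eqxx homog0 mulr1; congr (_ * _).
  rewrite (eq_bigr (fun=> B^-1)) ?prodr_const ?card_ord ?exprVn// => i _.
  by rewrite mxE eq_sym (negbTE (neq_lift _ _)) eqxx.
apply/is_trig_mxP => i j ij; rewrite mxE.
have -> : (j == ord0) = false by apply/negbTE; rewrite -lt0n (leq_trans _ ij).
by rewrite (_ : (i == j) = false)//; apply/eqP => h; rewrite h ltnn in ij.
Qed.

Lemma minor_flow_avoid0 A B (y : 'rV[R]_n) j (V : 'M[R]_(j, n.+1)) (c : 'I_j -> 'I_n.+1) :
  (forall a, c a != ord0) -> minor c (V *m flow A B y) = B ^- j * minor c V.
Proof.
move=> c0; rewrite /minor -exprVn -detZ; congr (\det _); apply/matrixP => a b.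
by rewrite [LHS]mxE mulmx_flow (negbTE (c0 b)) !mxE.
Qed.

(** Expansion along the only column that involves [y]; the [j] remaining columns each contribute a
    factor B^-1. *)
Lemma minor_flow_head0 A B (y : 'rV[R]_n) j (V : 'M[R]_(j.+1, n.+1))
    (J : {set 'I_n.+1}) : ord0 \notin J -> #|J| = j ->
  minor (fun a : 'I_j.+1 => nth ord0 (ord0 :: enum J) a) (V *m flow A B y) =
  A * B ^- j * \sum_k homog y 0 k * cw j.+1 (wcoord V) k J.
Proof.
move=> J0 cJ; set c := fun a => _.
have cl a : c (lift ord0 a) != ord0.
  have -> : c (lift ord0 a) = nth ord0 (enum J) a by [].
  by apply: contraNneq J0 => <-; rewrite -mem_enum mem_nth// -cardE cJ.
have cwE k : cw j.+1 (wcoord V) k J =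
    \sum_r V r k * cofactor (colsub c V) r ord0.
  rewrite cw_minor// /minor (expand_det_col _ ord0); apply: eq_bigr => r _.
  rewrite mxE /=; congr (_ * _); rewrite /cofactor; congr (_ * \det _).
  by apply/matrixP => a b; rewrite !mxE.
rewrite /minor (expand_det_col _ ord0).
transitivity (\sum_r A * (\sum_k V r k * homog y 0 k) *
    (B ^- j * cofactor (colsub c V) r ord0)).
  apply: eq_bigr => r _; congr (_ * _); first by rewrite mxE mulmx_flow.
  rewrite /cofactor mulrCA; congr (_ * _); rewrite -exprVn -detZ; congr (\det _).
  apply/matrixP => a b; do 3! rewrite [LHS]mxE.
  by rewrite mulmx_flow (negbTE (cl b)) !mxE.
under eq_bigr => r _ do rewrite mulrACA.
rewrite -mulr_sumr; congr (_ * _).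
under [RHS]eq_bigr => k _ do rewrite cwE mulr_sumr.
rewrite exchange_big; apply: eq_bigr => r _ /=; rewrite mulr_suml.
by apply: eq_bigr => k _; rewrite mulrA [V r k * _]mulrC.
Qed.

End CovolumeBound.

Section Covolume.
Context {R : realType} {n : nat}.

Lemma maxminor_full (V : 'M[int]_n.+1) A B (y : 'rV[R]_n) : 0 < A -> 0 < B ->
  row_free (intmx V : 'M[R]_(n.+1, n.+1)) ->
  A * B ^- n <= maxminor (intmx V *m flow A B y).
Proof.
move=> A0 B0 fV; rewrite maxminor_mulmx.
have idE (M : 'M[R]_n.+1) : \det M = minor id M.
  by congr (\det _); apply/matrixP => a b; rewrite mxE.
have V1 : 1 <= `|\det (intmx V : 'M[R]_n.+1)|.
  by rewrite idE minor_intmx_ge1// -idE -unitfE -unitmxE -row_free_unit.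
apply: (@le_trans _ _ (maxminor (flow A B y))); last first.
  by rewrite ler_peMl// maxminor_ge0.
apply: le_trans (minor_le_maxminor id _); rewrite -idE det_flow ger0_norm//.
by rewrite mulr_ge0 ?invr_ge0 ?exprn_ge0// ltW.
Qed.

(** Pigeonhole on the entries: if none exceeded the threshold, the factor 2 would make the norm at
    most half of itself. *)
Lemma Rc_norm_entry s (Rm : 'M[R]_(1 + s, 1 + n)) j (w : {set 'I_n.+1} -> R) :
  0 < Rc_norm Rm j w -> exists i J,
  Rc_norm Rm j w / (2 * ((1 + s)%:R * nsets (R := R) (m := n))) <
    `|\sum_k Rm i k * cw j w k J|.
Proof.
move=> Rc0; set d := _ / _; apply: contrapT => nex.
have n0 : 0 < nsets (R := R) (m := n).
  by rewrite ltr0n; apply/card_gt0P; exists finset.set0.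
have d0 : 0 <= d by rewrite divr_ge0 ?mulr_ge0 ?ltW.
have h i J : `|\sum_k Rm i k * cw j w k J| <= d.
  by rewrite leNgt; apply/negP => h; apply: nex; exists i, J.
have := Rc_norm_le d0 h; set D := _%:R * _ => hD.
have D0 : 0 < D by rewrite mulr_gt0// ltr0n.
have : Rc_norm Rm j w <= Rc_norm Rm j w / 2.
  apply: le_trans hD _; rewrite /d -/D (_ : D * _ = Rc_norm Rm j w / 2)//.
  by field; rewrite gt_eqF.
by move: Rc0; lra.
Qed.

(** In rank j+1 <= n, either |pi(w)| >= K B^(j+1) and a minor avoiding column 0 suffices, or the
    uniform form of (iii) is applied with [u j]. As (j+1) u_j = v + e - j, the powers of B then
    combine to B^(-(v+e)). The slack [e] puts [u j] strictly above the critical exponent. *)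
Lemma covolume_bound (X : Type) (f : X -> 'rV[R]_n) (Q : set X) (s : nat)
    (L : set 'rV[R]_n) (Rm : 'M[R]_(1 + s, 1 + n)) (v e : R) :
  admissible L Rm -> cond_iii v Rm -> n%:R <= v -> 0 < e ->
  Q !=set0 -> aff_span (f @` Q) = L ->
  exists2 kap : R, 0 < kap & forall A B : R, 0 < A -> 1 <= B ->
    1 <= A * B `^ (- (v + e)) * kap ->
    forall j (V : 'M[int]_(j, n.+1)), (0 < j)%N ->
      row_free (intmx V : 'M[R]_(j, n.+1)) ->
      exists2 z, Q z & 1 <= maxminor (intmx V *m flow A B (f z)).
Proof.
move=> adm H nv e0 [x0 Qx0] QL.
have R0 := admissible_col0 adm.
have v0 : 0 <= v by apply: le_trans nv.
have [k' k'0 hk'] := nonplanar_functional adm (ex_intro _ x0 Qx0) QL.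
pose u j : R := (v + e - j%:R) / j.+1%:R.
have u0 j : (j.+1 <= n)%N -> 0 <= u j.
  move=> jn; rewrite divr_ge0// subr_ge0.
  have : (j%:R : R) <= n%:R by rewrite ler_nat ltnW.
  by move: nv e0; lra.
have /choice[kj hkj] : forall j, exists k : R, 0 < k /\ ((j.+1 <= n)%N ->
    forall V : 'M[int]_(j.+1, n.+1), row_free (intmx V : 'M[R]_(j.+1, n.+1)) ->
    let w := wcoord (intmx V : 'M[R]_(j.+1, n.+1)) in
    k * Num.max 1 (ext_norm (proj0 w)) `^ (- u j) <= Rc_norm Rm j.+1 w).
  move=> j; have [jn|jn] := leqP j.+1 n; last by exists 1.
  have [|k k0 hk] := cond_iii_uniform R0 H jn _ (u0 j jn); last by exists k.
  by rewrite /u ltr_pM2r ?invr_gt0// -natr1; move: e0; lra.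
pose K := nsets (R := R) (m := n).
have K1 : 1 <= K by rewrite ler1n; apply/card_gt0P; exists finset.set0.
have K0 : 0 < K by apply: lt_le_trans K1.
pose g j := k' * (kj j * K `^ (- u j) / (2 * ((1 + s)%:R * K))).
have g0 j : 0 < g j.
  by rewrite !mulr_gt0 ?powR_gt0// ?invr_gt0 ?mulr_gt0//; have [] := hkj j.
(* Starting the minimum at 1 lets the same [kap] serve rank n+1. *)
pose kap := \big[Num.min/1]_(j < n) g j.
have kap1 : kap <= 1 by exact: bigmin_le_id.
have kap0 : 0 < kap by rewrite /kap lt_bigmin// => j _; exact: g0.
exists kap => // A B A0 B1 AB j V j0 fV.
have B0 : 0 < B by apply: lt_le_trans B1.
have AB1 : 1 <= A * B `^ (- (v + e)).
  by apply: le_trans AB _; rewrite ler_piMr// mulr_ge0 ?powR_ge0// ltW.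
have jn : (j <= n.+1)%N by rewrite -(eqP fV) rank_leq_col.
case: j j0 jn V fV => // j _; rewrite ltnS leq_eqVlt => /orP[/eqP jn|jn] V fV.
  subst j; exists x0 => //; apply: le_trans (maxminor_full _ A0 B0 fV).
  apply: le_trans AB1 _; rewrite ler_pM2l// -powR_mulrn ?(ltW B0)// -powRN.
  by apply: ler_powR => //; rewrite lerN2; move: nv e0; lra.
have [kj0 hV] := hkj j; have := hV jn V fV => /=; set w := wcoord _.
set P := ext_norm (proj0 w) => hP.
have [PB|PB] := leP (K * B ^+ j.+1) P.
  have P0 : 0 < P by apply: lt_le_trans PB; rewrite mulr_gt0 ?exprn_gt0.
  have [c [_ c0 _ _ /andP[_ Pc]]] := largest_minor P0.
  exists x0 => //; apply: le_trans (minor_le_maxminor c _).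
  rewrite minor_flow_avoid0// normrM gtr0_norm ?invr_gt0 ?exprn_gt0//.
  rewrite mulrC ler_pdivlMr ?exprn_gt0// mul1r -(ler_pM2l K0).
  exact: le_trans PB Pc.
have maxP : Num.max 1 P <= K * B ^+ j.+1.
  by rewrite ge_max (ltW PB) andbT mulr_ege1// exprn_ege1.
have max0 : 0 < Num.max 1 P by rewrite lt_max ltr01.
have Rc0 : 0 < Rc_norm Rm j.+1 w by apply: lt_le_trans hP; rewrite mulr_gt0 ?powR_gt0.
have [i [J hJ]] := Rc_norm_entry Rc0.
have [J0 cJ] : ord0 \notin J /\ #|J| = j.
  suff /andP[J0 /eqP cJ] : (ord0 \notin J) && (#|J| == j) by [].
  apply: contraLR hJ => nJ; rewrite big1 ?normr0 => [|k _].
    by rewrite -leNgt divr_ge0// ?mulr_ge0// ltW.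
  by rewrite /cw /= (negbTE nJ) mulr0.
have [z Qz hz] := hk' (fun k => cw j.+1 w k J) i.
exists z => //; set c := fun a : 'I_j.+1 => nth ord0 (ord0 :: enum J) a.
apply: le_trans (minor_le_maxminor c _); rewrite minor_flow_head0// normrM.
have ABj0 : 0 <= A * B ^- j by rewrite mulr_ge0 ?invr_ge0 ?exprn_ge0// ltW.
rewrite ger0_norm//.
apply: (@le_trans _ _ (A * B ^- j * (k' * (Rc_norm Rm j.+1 w / (2 * ((1 + s)%:R * K)))))); last first.
  by rewrite ler_wpM2l//; apply: le_trans hz; rewrite ler_pM2l// ltW.
apply: (@le_trans _ _ (A * B ^- j * (k' * (kj j * (K * B ^+ j.+1) `^ (- u j) / (2 * ((1 + s)%:R * K)))))); last first.
  rewrite ler_wpM2l// ler_pM2l// ler_pM2r ?invr_gt0 ?mulr_gt0//.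
  apply: le_trans hP; rewrite ler_pM2l// !powRN lef_pV2 ?posrE ?powR_gt0//; last first.
    by rewrite mulr_gt0// exprn_gt0.
  by apply: ge0_ler_powR; rewrite ?u0// nnegrE ltW// mulr_gt0// exprn_gt0.
have -> : A * B ^- j * (k' * (kj j * (K * B ^+ j.+1) `^ (- u j) / (2 * ((1 + s)%:R * K)))) =
    A * B `^ (- (v + e)) * g j.
  have -> : (K * B ^+ j.+1) `^ (- u j) = K `^ (- u j) * B `^ (- (v + e - j%:R)).
    rewrite powRM ?exprn_ge0 ?ltW// -powR_mulrn ?(ltW B0)// -powRrM; congr (_ * _ `^ _).
    by rewrite /u mulrN mulrC divfK.
  have -> : B `^ (- (v + e)) = B ^- j * B `^ (- (v + e - j%:R)).
    rewrite -powR_mulrn ?(ltW B0)// -powRN -powRD ?(gt_eqF B0) ?implybT//.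
    by congr (_ `^ _); ring.
  rewrite /g; ring.
apply: le_trans AB _; rewrite ler_wpM2l ?mulr_ge0 ?powR_ge0 ?(ltW A0)//.
exact: (bigmin_le _ (Ordinal jn) (fun j : 'I_n => g j)).
Qed.

End Covolume.

(** * Dyadic scales *)

Section Scales.
Context {R : realType} {n : nat}.

Lemma finite_supn (M : R) : finite_set [set q : 'rV[int]_n | supn q < M].
Proof.
pose N := (Num.truncn M).+1.
pose phi (g : {ffun 'I_n -> 'I_(N + N)}) : 'rV[int]_n := \row_i ((g i : nat)%:Z - N%:Z).
apply: (@sub_finite_set _ _ (phi @` setT)); last exact/finite_image/finite_finset.
move=> q /= qM.
have qN i : (absz (q 0%R i) < N)%N.
  rewrite -(ltr_nat R); apply: (lt_trans _ (truncnS_gt M)).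
  by apply: le_lt_trans qM; rewrite natr_absz; exact: le_supn.
have lt i : (absz (q 0 i + N%:Z)%R < N + N)%N by have := qN i; lia.
exists [ffun i => Ordinal (lt i)] => //; apply/rowP => i; rewrite mxE ffunE /=.
by have := qN i; lia.
Qed.

(** For 2^l <= |q| < 2^(l+1) one has |q|^(-w) <= (2^l)^(-w), so every solution satisfies |q| <
    2^l1. *)
Lemma not_Wset_of_dyadic (w : R) (y : 'rV[R]_n) (l1 : nat) : 0 < w ->
  (forall l (q : 'rV[int]_n) (p : int), (l1 <= l)%N -> q != 0 ->
     supn q < 2 * 2 ^+ l :> R ->
     (2 ^+ l) `^ (- w) <= `|\sum_i y 0 i * (q 0 i)%:~R + p%:~R|) ->
  ~ Wset w y.
Proof.
move=> w0 H; apply; apply: sub_finite_set (finite_supn (2 ^+ l1)) => q /= [q0 [p hp]].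
rewrite ltNge; apply/negP => ql1.
have q1 : 1 <= supn q :> R by exact: supn_ge1.
have exk : exists k, supn q < 2 ^+ k :> R.
  exists (Num.truncn (supn q : R)).+1.
  apply: lt_trans (truncnS_gt _) _; rewrite -natrX ltr_nat; exact: ltn_expl.
case: (ex_minnP exk) => -[|l] hl lmin; first by move: hl; rewrite expr0 ltNge q1.
have lq : 2 ^+ l <= supn q :> R.
  by rewrite leNgt; apply/negP => /lmin; rewrite ltnn.
have l1l : (l1 <= l)%N.
  rewrite leqNgt; apply/negP => ll1; have := le_lt_trans ql1 hl.
  by rewrite ltr_eXn2l ?ltr1n// ltnS leqNgt ll1.
have := H l q p l1l q0 _; rewrite -exprS => /(_ hl); rewrite leNgt => /negP; apply.
apply: lt_le_trans hp _; rewrite !powRN lef_pV2 ?posrE ?powR_gt0 ?exprn_gt0//; last first.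
  by apply: lt_le_trans q1.
apply: ge0_ler_powR => //; rewrite ?nnegrE ?exprn_ge0//; first exact: ltW.
by apply: le_trans q1.
Qed.

(* At [T = 2^l] and [eps = T^-delta], the values of [A] and [B] are such that
   vectors of norm below [eps / (n + 2)] correspond to [|q| < 2 T] and
   [|q . y + p| < T^-w]; [delta] is small enough for scale_condition. *)
Definition scale_delta (v w : R) : R := (w - v) / (4 * (1 + (v + (w - v) / 2))).
Definition scale_eps (v w : R) (l : nat) : R := (2 ^+ l) `^ (- scale_delta v w).
Definition scale_B (v w : R) (l : nat) : R := 2 * n.+2%:R * 2 ^+ l / scale_eps v w l.
Definition scale_A (v w : R) (l : nat) : R :=
  scale_eps v w l * (2 ^+ l) `^ w / n.+2%:R.

Context (v w : R).
Hypotheses (v0 : 0 <= v) (vw : v < w).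

Lemma scale_delta_gt0 : 0 < scale_delta v w.
Proof. by rewrite divr_gt0 ?subr_gt0// mulr_gt0//; move: v0 vw; lra. Qed.

Lemma scale_eps_gt0 l : 0 < scale_eps v w l.
Proof. by rewrite powR_gt0// exprn_gt0. Qed.

Lemma scale_eps_le1 l : scale_eps v w l <= 1.
Proof.
rewrite -(powRr0 (2 ^+ l)) ler_powR ?exprn_ege1 ?ler1n//.
by rewrite oppr_le0 ltW// scale_delta_gt0.
Qed.

Lemma scale_A_gt0 l : 0 < scale_A v w l.
Proof. by rewrite !mulr_gt0 ?scale_eps_gt0 ?powR_gt0 ?exprn_gt0// invr_gt0. Qed.

Lemma scale_B_ge1 l : 1 <= scale_B v w l.
Proof.
rewrite ler_pdivlMr ?scale_eps_gt0// mul1r; apply: le_trans (scale_eps_le1 l) _.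
by rewrite !mulr_ege1// ?exprn_ege1 ?ler1n.
Qed.

Lemma scale_condition (kap : R) : 0 < kap -> exists l0 : nat, forall l, (l0 <= l)%N ->
  1 <= scale_A v w l * scale_B v w l `^ (- (v + (w - v) / 2)) * kap.
Proof.
move=> kap0; set e := v + (w - v) / 2; set d := scale_delta v w.
have e0 : 0 < 1 + e by rewrite /e; move: v0 vw; lra.
pose N2 : R := n.+2%:R; have N20 : 0 < N2 by rewrite ltr0n.
pose C := N2^-1 * (2 * N2) `^ (- e) * kap.
have C0 : 0 < C by rewrite !mulr_gt0 ?invr_gt0 ?powR_gt0// mulr_gt0.
have th : 0 < (w - v) / 4 by move: vw; lra.
have [M M0 hM] := powR_unbounded C^-1 th.
exists (Num.truncn M).+1 => l ll; set T : R := 2 ^+ l.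
have T0 : 0 < T by rewrite exprn_gt0.
have MT : M < T.
  apply: lt_trans (truncnS_gt M) _; apply: (@le_lt_trans _ _ l%:R).
    by rewrite ler_nat.
  by rewrite /T -natrX ltr_nat; exact: ltn_expl.
have TT (a b : R) : T `^ (a + b) = T `^ a * T `^ b.
  by rewrite powRD// (gt_eqF T0) implybT.
have -> : scale_A v w l * scale_B v w l `^ (- e) * kap = C * T `^ ((w - v) / 4).
  (* The exponent of T is (w - v)/2 - d (1 + e), and [scale_delta] is chosen so that d (1 + e) = (w
     - v)/4. *)
  have -> : (w - v) / 4 = (- d) + w + (- e) + (d * - e).
    rewrite /d /scale_delta -/e /e; field.
    by rewrite gt_eqF//; move: e0; rewrite /e; lra.
  rewrite !TT /scale_A /scale_B /scale_eps -/d -/T -/N2.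
  have -> : 2 * N2 * T / T `^ (- d) = 2 * N2 * (T * T `^ d).
    by rewrite powRN invrK mulrA.
  rewrite (@powRM _ (2 * N2)) ?mulr_ge0 ?powR_ge0 ?(ltW T0) ?(ltW N20)//.
  rewrite (@powRM _ T) ?powR_ge0 ?(ltW T0)// -powRrM /C; ring.
rewrite -ler_pdivrMl// mulr1; exact/ltW/hM.
Qed.

(** The threshold eps/(n+2) times [scale_B] is 2 * 2^l, so the large coordinate cannot come from
    [q]; divided by [scale_A] it is (2^l)^(-w). *)
Lemma no_short_vector_dyadic (y : 'rV[R]_n) (l : nat) :
  (forall r : 'rV[int]_n.+1, r != 0 -> exists k, scale_eps v w l / n.+2%:R <=
     `|(intmx r *m flow (scale_A v w l) (scale_B v w l) y) 0 k|) ->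
  forall (q : 'rV[int]_n) (p : int), q != 0 -> supn q < 2 * 2 ^+ l :> R ->
     (2 ^+ l) `^ (- w) <= `|\sum_i y 0 i * (q 0 i)%:~R + p%:~R|.
Proof.
move=> H q p q0 ql.
pose r : 'rV[int]_n.+1 := \row_k (if unlift ord0 k is Some i then q 0 i else p).
have r0 : r ord0 ord0 = p by rewrite mxE unlift_none.
have rl i : r ord0 (lift ord0 i) = q 0 i by rewrite mxE liftK.
have e0 := scale_eps_gt0 l; have A0 := scale_A_gt0 l.
have B0 : 0 < scale_B v w l by apply: lt_le_trans (scale_B_ge1 l).
have N0 : 0 < n.+2%:R :> R by rewrite ltr0n.
have [|k] := H r.
  apply: contraNneq q0 => rz; apply/eqP/rowP => i.
  by rewrite -rl rz !mxE.
rewrite (mulmx_flow _ _ _ (intmx r)); case: (unliftP ord0 k) => [i ->|->].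
  rewrite eq_sym (negbTE (neq_lift _ _)) mxE rl normrM gtr0_norm ?invr_gt0//.
  move=> h; have : supn q < supn q :> R; last by rewrite ltxx.
  apply: lt_le_trans ql _; apply: le_trans (le_supn q i); rewrite intr_norm.
  move: h; rewrite [leRHS]mulrC ler_pdivlMr// /scale_B => h; apply: le_trans h.
  by rewrite le_eqVlt; apply/orP; left; apply/eqP; field; rewrite !gt_eqF.
rewrite eqxx homog_sum mxE r0 normrM gtr0_norm// => h.
have -> : \sum_i y 0 i * (q 0 i)%:~R + p%:~R =
    p%:~R + \sum_i intmx r 0 (lift ord0 i) * y 0 i.
  rewrite addrC; congr (_ + _); apply: eq_bigr => i _; by rewrite [intmx _ _ _]mxE rl mulrC.
rewrite -(ler_pM2l A0); apply: le_trans h; rewrite /scale_A powRN.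
rewrite le_eqVlt; apply/orP; left; apply/eqP; field.
by rewrite !gt_eqF// powR_gt0// exprn_gt0.
Qed.

End Scales.

(** * Local null sets *)

Section Continuity.
Context {R : realType} {X : pointedType} (dist : X -> X -> R) {n : nat}.
Hypothesis dist_metric : is_metric dist.
Context (f : X -> 'rV[R]_n).
Hypothesis fcont : mcontinuous dist f.

Lemma mopen_affine_lt (c0 : R) (b : 'rV[R]_n) (e : R) :
  mopen dist [set x | `|c0 + \sum_i b 0 i * f x 0 i| < e].
Proof.
move=> x /= xe; set g := fun y => c0 + \sum_i b 0 i * f y 0 i.
pose S : R := 1 + \sum_i `|b 0 i|.
have S0 : 0 < S by rewrite ltr_pwDl// sumr_ge0.
pose e' := (e - `|g x|) / S.
have e'0 : 0 < e' by rewrite divr_gt0// subr_gt0.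
have [d d0 hd] := fcont x e'0; exists d => // y xy /=.
have gg : `|g y - g x| < e - `|g x|.
  have -> : g y - g x = \sum_i b 0 i * (f y 0 i - f x 0 i).
    rewrite /g opprD addrACA subrr add0r -sumrB; apply: eq_bigr => i _; by rewrite mulrBr.
  apply: le_lt_trans (ler_norm_sum _ _ _) _.
  apply: (@le_lt_trans _ _ (\sum_i `|b 0 i| * e')).
    by apply: ler_sum => i _; rewrite normrM ler_wpM2l// ltW// hd.
  rewrite -mulr_suml /e' mulrCA gtr_pMr ?subr_gt0// ltr_pdivrMr// mul1r.
  by rewrite /S ltrDr.
have := ler_normD (g x) (g y - g x); rewrite addrC subrK => h.
by apply: le_lt_trans h _; rewrite -ltrBrDl.
Qed.

Lemma mopen_forall (I : finType) (U : I -> set X) :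
  (forall i, mopen dist (U i)) -> mopen dist [set x | forall i, U i x].
Proof.
move=> oU x Ux.
have /choice[r hr] i : exists r : R, 0 < r /\ mball dist x r `<=` U i.
  by have [r r0 hr] := oU i x (Ux i); exists r.
exists (\big[Num.min/1]_i r i).
  by rewrite lt_bigmin// => i _; have [] := hr i.
move=> y xy i; have [_] := hr i; apply; apply: lt_le_trans xy _; exact: bigmin_le.
Qed.

Lemma mopen_maxminor_lt A B j (V : 'M[R]_(j, n.+1)) (e : R) : 0 < e ->
  mopen dist [set x | maxminor (V *m flow A B (f x)) < e].
Proof.
move=> e0; have -> : [set x | maxminor (V *m flow A B (f x)) < e] =
    [set x | forall c : {ffun 'I_j -> 'I_n.+1}, `|minor c (V *m flow A B (f x))| < e].
  apply/seteqP; split => x /= h.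
    by move=> c; apply: le_lt_trans h; exact: minor_le_maxminor.
  by apply: bigmax_lt.
apply: mopen_forall => c; have [c0 [b hb]] := minor_flow_affine A B V c.
apply: (eq_ind _ (mopen dist) (mopen_affine_lt (c0 := c0) (b := b) (e := e))).
by apply/seteqP; split => x /=; rewrite hb.
Qed.

End Continuity.

Section LocalNull.
Context {R : realType} {X : pointedType} (dist : X -> X -> R).
Context (mu : {measure set (g_sigma_algebraType (mopen dist)) -> \bar R}).
Context {n : nat} (f : X -> 'rV[R]_n).
Hypothesis dist_metric : is_metric dist.
Hypothesis fcont : mcontinuous dist f.

Local Notation ball := (mball dist).
Local Notation T := (g_sigma_algebraType (mopen dist)).
Local Notation meas := (@measurable _ T).

Lemma supp_ball_gt0 y r : supp mu y -> 0 < r -> (0 < mu (ball y r))%E.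
Proof. by move=> sy r0; exact: sy. Qed.

Lemma federer_on_le (D : R) (U : set X) y t :
  federer_on mu D U -> supp mu y -> 0 < t -> ball y (3 * t) `<=` U ->
  (mu (ball y (3 * t)) < +oo)%E ->
  (mu (ball y (3 * t)) <= (Num.max D 0)%:E * mu (ball y t))%E.
Proof.
move=> fed sy t0 yU fin3.
have t3 : t <= 3 * t by rewrite ler_peMl ?ler1n// ltW.
have mle : (mu (ball y t) <= mu (ball y (3 * t)))%E.
  apply: le_measure; rewrite ?inE; try exact: measurable_mball.
  exact: mball_le.
have h : (mu (ball y (3 * t)) * (mu (ball y t))^-1 < D%:E)%E.
  apply: le_lt_trans fed; apply: ereal_sup_ubound.
  by exists y, t.
have m0 := supp_ball_gt0 sy t0.
have fin1 : (mu (ball y t) < +oo)%E by apply: le_lt_trans fin3.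
have m3 : (0 <= mu (ball y (3 * t)))%E by exact: measure_ge0.
move: h fin3 m3; case: (mu (ball y (3 * t))) => [b| |] h fin3 m3 //.
move: h m0 fin1; case: (mu (ball y t)) => [a| |] h m0 fin1 //.
move: h m0; rewrite lte_fin => h a0; move: h; rewrite inver gt_eqF// -!EFinM lte_fin => h.
rewrite lee_fin -ler_pdivrMr//; apply: (le_trans (ltW h)).
by rewrite le_max lexx.
Qed.

Lemma good_on_measure (C alpha eps : R) (g : X -> R) (U : set X) y r z :
  0 < C -> 0 < alpha -> good_on mu C alpha g U ->
  supp mu y -> 0 < r -> ball y r `<=` U -> 0 < eps ->
  ball y r z -> supp mu z -> 1 <= `|g z| ->
  (mu (ball y r `&` [set x | `|g x| < eps]%R) <= (C * eps `^ alpha)%:E * mu (ball y r))%E.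
Proof.
move=> C0 a0 gd sy r0 yU e0 yz sz gz; apply: le_trans (gd y r sy r0 yU eps e0) _.
rewrite lee_wpmul2r ?measure_ge0// EFinM.
apply: lee_wpmul2l; first by rewrite lee_fin ltW.
have N1 : (1 <= norm_mu mu g (ball y r))%E.
  apply: (@le_trans _ _ (`|g z|)%:E); first by rewrite lee_fin.
  by apply: ereal_sup_ubound; exists z.
(* An infinite supremum has inverse 0, and 0^alpha = 0. *)
case: (norm_mu mu g (ball y r)) N1 => [N| |]//; last first.
  by rewrite invey mule0 poweR0r ?gt_eqF// lee_fin powR_ge0.
rewrite lee_fin => N1; have N0 : 0 < N by apply: lt_le_trans N1.
rewrite inver gt_eqF// -EFinM poweR_EFin lee_fin ge0_ler_powR ?nnegrE ?(ltW a0) ?(ltW e0)//.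
  by rewrite divr_ge0 ?(ltW e0) ?(ltW N0).
by rewrite ler_piMr ?(ltW e0)// invf_le1.
Qed.

Lemma geometric_sum_le (r : R) (k : nat) : 0 <= r -> r < 1 ->
  \sum_(0 <= i < k) r ^+ i <= (1 - r)^-1.
Proof.
move=> r0 r1; have d0 : 0 < 1 - r by rewrite subr_gt0.
have e : (1 - r) * \sum_(0 <= i < k) r ^+ i = 1 - r ^+ k.
  elim: k => [|k IH]; first by rewrite big_nil mulr0 expr0 subrr.
  by rewrite big_nat_recr//= mulrDr IH exprS; ring.
by rewrite -(ler_pM2l d0) e divff ?gt_eqF// gerBl exprn_ge0.
Qed.

Lemma negligible_lim_sup (Z : nat -> set T) (a r : R) :
  0 <= a -> 0 <= r -> r < 1 -> (forall l, meas (Z l)) ->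
  (forall l, (mu (Z l) <= (a * r ^+ l)%:E)%E) -> mu (lim_sup_set Z) = 0%E.
Proof.
move=> a0 r0 r1 mZ hZ; apply: lim_sup_set_cvg0 => //.
apply: (@le_lt_trans _ _ (a * (1 - r)^-1)%:E); last exact: ltry.
apply: lime_le; first by apply: is_cvg_nneseries => l _ _; exact: measure_ge0.
apply: nearW => k; apply: (@le_trans _ _ (\sum_(0 <= l < k) (a * r ^+ l)%:E)%E).
  by apply: lee_sum => l _; exact: hZ.
by rewrite sumEFin lee_fin -mulr_sumr ler_wpM2l// geometric_sum_le.
Qed.

Lemma Wset_locally_null (N s : nat) (L : set 'rV[R]_n) (Rm : 'M[R]_(1 + s, 1 + n))
    (v w D C alpha r0 : R) (U1 U2 : set X) (x0 : X) :
  besicovitch_with dist N -> nonplanar mu f L ->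
  admissible L Rm -> cond_iii v Rm -> n%:R <= v -> v < w ->
  supp mu x0 -> mopen dist U1 -> U1 x0 -> federer_on mu D U1 ->
  mopen dist U2 -> U2 x0 -> 0 < C -> 0 < alpha ->
  (forall (c0 : R) (c : 'rV[R]_n),
     good_on mu C alpha (fun y => c0 + \sum_i c 0 i * f y 0 i) U2) ->
  0 < r0 -> (mu (ball x0 r0) < +oo)%E ->
  exists2 r, 0 < r &
    mu.-negligible (ball x0 r `&` (supp mu `&` [set x | Wset w (f x)]) : set T).
Proof.
move=> bes npl adm H nv vw sx0 oU1 U1x fed oU2 U2x C0 alpha0 gd r00 fin0.
have v0 : 0 <= v by apply: le_trans nv.
have w0 : 0 < w by apply: le_lt_trans vw.
pose U := U1 `&` (U2 `&` ball x0 r0).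
have oU : mopen dist U.
  by apply: mopenI => //; apply: mopenI => //; exact: mopen_mball.
have [r1 r10 r1U] := oU x0 (conj U1x (conj U2x (mball_center dist_metric x0 r00))).
(* One factor 10 for each of the ranks 1, ..., n+1 treated by [nondivergence]. *)
pose r := r1 / 10 ^+ n.+1.
have t0 : 0 < 10 ^+ n.+1 :> R by rewrite exprn_gt0.
have r_gt0 : 0 < r by rewrite divr_gt0.
have rU : ball x0 (10 ^+ n.+1 * r) `<=` U by rewrite mulrC divfK ?gt_eqF.
exists r => //.
have finU y t : ball y t `<=` U -> (mu (ball y t) < +oo)%E.
  move=> yU; apply: le_lt_trans fin0; apply: le_measure; rewrite ?inE.
  - exact: measurable_mball.
  - exact: measurable_mball.
  - by move=> z /yU[_ []].
pose Q := ball x0 r `&` supp mu.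
have Qx0 : Q x0 by split => //; exact: mball_center.
have QL : aff_span (f @` Q) = L.
  apply: npl; [exact: mopen_mball|by exists x0; exact: mball_center|exact: sx0].
have e0 : 0 < (w - v) / 2 by rewrite divr_gt0 ?subr_gt0.
have [kap kap0 hkap] := covolume_bound adm H nv e0 (ex_intro _ x0 Qx0) QL.
have [l0 hl0] := scale_condition (n := n) v0 vw kap0.
pose eps := scale_eps v w.
pose D' := Num.max D 0; have D'0 : 0 <= D' by rewrite le_max lexx orbT.
pose cst := nondiv_const N D' n.+1; have cst0 : 0 <= cst by exact: nondiv_const_ge0.
pose G l x := flow (scale_A (n := n) v w l) (scale_B (n := n) v w l) (f x).
have hex : forall l : nat, exists Z : set T, [/\ meas Z,
    (mu Z <= (cst * (C * eps l `^ alpha))%:E * mu (ball x0 r))%E &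
    (l0 <= l)%N -> forall z, ball x0 r z -> supp mu z -> ~ Z z ->
      marked (@tag _ _) (@lattice_cmp R n) (fun s x => maxminor (lmx s *m G l x)) (eps l)
        (@lattice_minimal R n) z].
  move=> l; have Ce0 : 0 <= C * eps l `^ alpha by rewrite mulr_ge0 ?powR_ge0// ltW.
  have [ll|ll] := leqP l0 l; last first.
    exists set0; split; [exact: measurable0| |by []].
    by rewrite measure0 mule_ge0// lee_fin mulr_ge0.
  have A0 : 0 < scale_A (n := n) v w l by exact: scale_A_gt0.
  pose psi (s' : @lattice n) (x : X) : R := maxminor (lmx s' *m G l x).
  have B1 : 1 <= scale_B (n := n) v w l by exact: scale_B_ge1.
  have eps0 : 0 < eps l by exact: scale_eps_gt0.
  have cref s' : @lattice_cmp R n s' s' by left.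
  have csym s' t' : @lattice_cmp R n s' t' -> @lattice_cmp R n t' s'.
    by case=> h; [right|left].
  have fedU y t : supp mu y -> 0 < t -> ball y (3 * t) `<=` U ->
      (mu (ball y (3 * t)) <= D'%:E * mu (ball y t))%E.
    move=> sy tp yU; apply: (federer_on_le fed) => //; last exact: finU.
    by move=> z /yU[].
  have contU s' z : @lattice_minimal R n s' -> psi s' z < 1 ->
      exists2 t, 0 < t & forall z', ball z t z' -> psi s' z' < 1.
    move=> _ hz; have [t tp ht] := mopen_maxminor_lt (A := scale_A (n := n) v w l)
      (B := scale_B (n := n) v w l) (V := lmx s') fcont ltr01 hz.
    by exists t => // z' /ht.
  have goodU s' y t : @lattice_minimal R n s' -> supp mu y -> 0 < t ->
      ball y t `<=` U -> (exists z, [/\ ball y t z, supp mu z & 1 <= psi s' z]) ->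
      exists Z : set T, [/\ meas Z,
        (mu Z <= (C * eps l `^ alpha)%:E * mu (ball y t))%E &
        forall z, ball y t z -> psi s' z < eps l -> Z z].
    (* A minor that is at least 1 at [z] is an affine combination of the coordinates of f, hence
       good; where all minors are below [eps l], so is this one. *)
    move=> _ sy tp yU [z [yz sz hz]]; have [c hc] := le_maxminorP ltr01 hz.
    have [c0 [b hb]] := minor_flow_affine (scale_A (n := n) v w l) (scale_B (n := n) v w l)
      (lmx s') c.
    pose g x := c0 + \sum_i b 0 i * f x 0 i.
    exists (ball y t `&` [set x | `|g x| < eps l]); split.
    - apply: measurableI; first exact: measurable_mball.
      apply: measurable_mopen; exact: mopen_affine_lt.
    - have gg : good_on mu C alpha g U2 by exact: gd.
      have yU2 : ball y t `<=` U2 by move=> x /yU[_ []].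
      by apply: (good_on_measure C0 alpha0 gg sy tp yU2 eps0 yz sz); rewrite /g -hb.
    - move=> x yx px; split => //=; rewrite /g -hb; apply: le_lt_trans px.
      exact: minor_le_maxminor.
  have ranks s' : @lattice_minimal R n s' ->
      @lattice_minimal R n s' /\ tag s' \in iota 1 n.+1.
    move=> ms; split => //; rewrite mem_iota; case: ms => -> [/eqP fs _] /=.
    by rewrite add1n ltnS -fs rank_leq_col.
  have sks : (size (iota 1 n.+1) <= n.+1)%N by rewrite size_iota.
  have hlarge s' : @lattice_minimal R n s' ->
      exists z, [/\ ball x0 r z, supp mu z & 1 <= psi s' z].
    move=> [s'0 [fs _]].
    by have [z [? ?] ?] := hkap _ _ A0 B1 (hl0 l ll) _ _ s'0 fs; exists z.
  have [Z [mZ muZ hZ]] := nondivergence (mu := mu) dist_metric cref csym bes D'0 Ce0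
    (scale_eps_le1 v0 vw l) fedU contU goodU sks ranks sx0 r_gt0 rU hlarge.
  by exists Z.
have [Z hZ] := choice hex.
have finr : (mu (ball x0 r) < +oo)%E.
  apply: finU; apply: subset_trans rU; apply: mball_le.
  by rewrite ler_peMl ?exprn_ege1 ?ler1n// ltW.
have finE : mu (ball x0 r) = (fine (mu (ball x0 r)))%:E.
  by rewrite fineK// ge0_fin_numE.
(* (eps l)^alpha = rho^l, so the bounds form a convergent geometric series. *)
pose rho : R := 2 `^ (- (scale_delta v w * alpha)).
have sd0 : 0 < scale_delta v w by exact: scale_delta_gt0.
have rho1 : rho < 1.
  have x0' : 0 < scale_delta v w * alpha by rewrite mulr_gt0.
  have one : 1 `^ (scale_delta v w * alpha) = 1 :> R by rewrite powR1.
  rewrite /rho powRN invf_lt1 ?powR_gt0// -[ltLHS]one.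
  by apply: gt0_ltr_powR => //; rewrite ?nnegrE ?ltr1n.
have Z0 : mu (lim_sup_set Z) = 0%E.
  apply: (@negligible_lim_sup Z (cst * C * fine (mu (ball x0 r))) rho) => //.
  - by rewrite mulr_ge0 ?fine_ge0 ?measure_ge0// mulr_ge0// ltW.
  - exact: powR_ge0.
  - by move=> l; have [] := hZ l.
  - move=> l; have [_ h _] := hZ l; apply: le_trans h _; rewrite finE -EFinM lee_fin.
    rewrite le_eqVlt; apply/orP; left; apply/eqP.
    have -> : eps l `^ alpha = rho ^+ l.
      rewrite -(powR_mulrn l (powR_ge0 2 _)) /eps /scale_eps.
      rewrite -(powR_mulrn l (ler0n R 2)) -!powRrM; congr (_ `^ _); ring.
    by rewrite /=; ring.
exists (lim_sup_set Z); split => //.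
  apply: bigcap_measurable => // k _; apply: bigcup_measurable => l _.
  by have [] := hZ l.
move=> z [xz [sz Wz]]; apply: contrapT => nZ.
have [k hk] : exists k, forall l, (k <= l)%N -> ~ Z l z.
  apply: contrapT => /forallNP nk; apply: nZ => k _.
  by have /existsNP[l /not_implyP[kl /contrapT Zl]] := nk k; exists l.
apply: (@not_Wset_of_dyadic _ _ w (f z) (maxn l0 k) w0 _ Wz) => l q p.
rewrite geq_max => /andP[l0l kl]; apply: (no_short_vector_dyadic v0 vw) => // rr rr0.
have [_ _ hm] := hZ l.
apply: (marked_no_short_vector (G := G l) (z := z) (scale_eps_gt0 v w l)
  (scale_eps_le1 v0 vw l) _ rr0).
by apply: hm => //; exact: hk.
Qed.

End LocalNull.

(** * The exponent of the pushforward *)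

Section Exponent.
Context {R : realType} {X : pointedType} (dist : X -> X -> R).
Context (mu : {measure set (g_sigma_algebraType (mopen dist)) -> \bar R}).
Context {n : nat} (f : X -> 'rV[R]_n).
Hypothesis dist_metric : is_metric dist.
Hypothesis fcont : mcontinuous dist f.

Local Notation T := (g_sigma_algebraType (mopen dist)).
Local Notation meas := (@measurable _ T).

Lemma mopen_bigcup (I : Type) (P : I -> Prop) (U : I -> set X) :
  (forall i, P i -> mopen dist (U i)) -> mopen dist [set x | exists2 i, P i & U i x].
Proof.
move=> oU x [i Pi Ux]; have [r r0 hr] := oU i Pi x Ux.
by exists r => // y /hr Uy; exists i.
Qed.

(** Infinitely many [q] means that for every k some [q] has code at least k. Each inequality is an
    open condition on x, so the set is a countable intersection of open sets. *)
Lemma measurable_Wset (u : R) : meas [set x | Wset u (f x)].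
Proof.
pose E (q : 'rV[int]_n) : set X := [set x | q != 0 /\ exists p : int,
  `|\sum_i f x 0 i * (q 0 i)%:~R + p%:~R| < supn q `^ (- u)].
have -> : [set x | Wset u (f x)] =
    \bigcap_k [set x | exists2 q, (k <= choice.pickle q)%N & E q x].
  apply/seteqP; split => x /=.
    move=> inf k _ /=; apply: contrapT => nex; apply: inf.
    apply: (@sub_finite_set _ _ (@choice.pickle _ @^-1` `I_k)).
      move=> q Eq /=; rewrite ltnNge; apply/negP => kq; apply: nex; by exists q.
    apply: finite_preimage; last exact: finite_II.
    by move=> ? ? _ _; exact: (pcan_inj choice.pickleK).
  move=> H /finite_seqP[s Ss].
  have [q kq Eq] := H (\max_(q <- s) choice.pickle q).+1 I.
  have qs : q \in s by have : [set` s] q by rewrite -Ss.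
  by move: kq; rewrite ltnNge => /negP; apply; exact: leq_bigmax_seq.
apply: bigcap_measurable => // k _; apply: measurable_mopen.
apply: mopen_bigcup => q _.
have [q0|q0] := eqVneq q 0.
  by move=> x []; rewrite q0 eqxx.
have -> : E q = [set x | exists2 p : int, True &
    `|p%:~R + \sum_i (\row_i (q 0 i)%:~R : 'rV[R]_n) 0 i * f x 0 i| < supn q `^ (- u)].
  have e x (p : int) : \sum_i f x 0 i * (q 0 i)%:~R + p%:~R =
      p%:~R + \sum_i (\row_i (q 0 i)%:~R : 'rV[R]_n) 0 i * f x 0 i.
    rewrite addrC; congr (_ + _); apply: eq_bigr => i _; by rewrite mxE mulrC.
  apply/seteqP; split => x /=; first by move=> [_ [p hp]]; exists p; rewrite -?e.
  by move=> [p _ hp]; split => //; exists p; rewrite e.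
by apply: mopen_bigcup => p _; exact: mopen_affine_lt.
Qed.

Lemma Wset_le (u1 u2 : R) (y : 'rV[R]_n) : u1 <= u2 -> Wset u2 y -> Wset u1 y.
Proof.
move=> u12 W fin; apply: W; apply: sub_finite_set fin => q [q0 [p hp]]; split => //.
by exists p; apply: lt_le_trans hp _; rewrite ler_powR ?supn_ge1// lerN2.
Qed.

(** For v >= 0 every u > v is positive, as the supremum defining [omega] demands. *)
Lemma lt_omegaP (v : R) (y : 'rV[R]_n) : 0 <= v ->
  (v%:E < omega y)%E <-> exists2 u, v < u & Wset u y.
Proof.
move=> v0; split.
  move/ereal_sup_gt => [_ [u [_ Wu] <-]]; rewrite lte_fin => vu; by exists u.
move=> [u vu Wu]; apply: (@lt_le_trans _ _ u%:E); first by rewrite lte_fin.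
by apply: ereal_sup_ubound; exists u => //; split => //; exact: le_lt_trans vu.
Qed.

Lemma measurable_lt_omega (v : R) : 0 <= v -> meas [set x | (v%:E < omega (f x))%E].
Proof.
move=> v0; have -> : [set x | (v%:E < omega (f x))%E] =
    \bigcup_k [set x | Wset (v + k.+1%:R^-1) (f x)].
  apply/seteqP; split => x /=.
    move/(lt_omegaP _ v0) => [u vu Wu].
    have uv : 0 < u - v by rewrite subr_gt0.
    pose k := Num.truncn (u - v)^-1; exists k => //=.
    apply: Wset_le Wu; rewrite -lerBrDl invf_ple ?posrE//.
    exact/ltW/truncnS_gt.
  move=> [k _ Wk]; apply/(lt_omegaP _ v0); exists (v + k.+1%:R^-1) => //.
  by rewrite ltrDl invr_gt0.
by apply: bigcup_measurable => k _; exact: measurable_Wset.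
Qed.

Lemma Wset_negligible (s : nat) (L : set 'rV[R]_n) (Rm : 'M[R]_(1 + s, 1 + n)) (v w : R) :
  besicovitch dist -> federer mu -> good mu f -> nonplanar mu f L ->
  admissible L Rm -> cond_iii v Rm -> n%:R <= v -> v < w ->
  mu.-negligible ([set x | Wset w (f x)] : set T).
Proof.
move=> bes [[locfin _ _] fed] gd npl adm H nv vw.
have [N besN] := bes.
pose F1 : set T := [set x | exists U D, [/\ mopen dist U, U x & federer_on mu D U]].
pose F2 : set T := [set x | exists V C alpha,
     [/\ mopen dist V, V x, 0 < C, 0 < alpha &
         forall (c0 : R) (c : 'rV[R]_n),
           good_on mu C alpha (fun y => c0 + \sum_i c 0 i * f y 0 i) V]].
pose W : set T := [set x | Wset w (f x)].
pose A : set T := supp mu `&` (F1 `&` F2).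
have cov : W `<=` ~` supp mu `|` (~` F1 `|` (~` F2 `|` (A `&` (supp mu `&` W)))).
  move=> x Wx; have [sx|] := pselect (supp mu x); last by left.
  have [x1|] := pselect (F1 x); last by right; left.
  have [x2|] := pselect (F2 x); last by right; right; left.
  by right; right; right.
apply: (negligibleS cov).
apply: negligibleU; first exact: negligible_compl_supp.
apply: negligibleU => //; apply: negligibleU => //.
apply: negligible_cover => // x [sx [[U1 [D [oU1 U1x fedU]]]]].
move=> [U2 [C [alpha [oU2 U2x C0 alpha0 gdU]]]].
have [r0 r00 fin0] := locfin x.
exact: (Wset_locally_null dist_metric fcont besN npl adm H nv vw sx oU1 U1x fedU oU2 U2x
  C0 alpha0 gdU r00 fin0).
Qed.

End Exponent.

Lemma admissible_exists {R : realType} (n s : nat) (L : set 'rV[R]_n) :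
  affine_subspace s L -> exists Rm : 'M[R]_(1 + s, 1 + n), admissible L Rm.
Proof.
move=> [p [U [rU ->]]]; subst s; pose B := row_base U.
exists (block_mx 1 p 0 B), (fun x => p + x *m B); split.
- by exists p, B.
- by move=> x /=; rewrite addrAC subrr add0r -(eq_row_base U) submxMl.
- move=> y /=; rewrite -(eq_row_base U) => /submxP[x yx]; exists x.
  by rewrite -/B -yx addrC subrK.
- by move=> x y /addrI; apply: row_free_inj; exact: row_base_free.
- move=> x; rewrite mul_row_block mulmx0 addr0.
  have -> : const_mx 1 = 1%:M :> 'M[R]_1.
    by apply/matrixP => i j; rewrite !mxE !ord1.
  by rewrite mulmx1 mul1mx.
Qed.

Unset Implicit Arguments.

Theorem theorem4p2 (R : realType) (X : pointedType) (dist : X -> X -> R)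
  (mu : {measure set (g_sigma_algebraType (mopen dist)) -> \bar R})
  (n s : nat) (L : set 'rV[R]_n) (f : X -> 'rV[R]_n) (v : R) :
  is_metric dist -> besicovitch dist ->
  (0 < mu setT)%E -> federer mu ->
  affine_subspace s L -> mcontinuous dist f -> (forall x, L (f x)) ->
  good mu f -> nonplanar mu f L ->
  n%:R <= v ->
  ((forall u : R, v < u -> exists x, supp mu x /\ ~ Wset u (f x)) <->
   (omega_push mu f <= v%:E)%E)
  /\
  ((omega_push mu f <= v%:E)%E <->
   exists Rm : 'M[R]_(1 + s, 1 + n), admissible L Rm /\ cond_iii v Rm)
  /\
  ((omega_push mu f <= v%:E)%E <->
   forall Rm : 'M[R]_(1 + s, 1 + n), admissible L Rm -> cond_iii v Rm).
Proof.
move=> dist_metric bes mu0 fed Laff fcont fL gd npl nv.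
have v0 : 0 <= v by apply: le_trans nv.
(* The implications close the cycle from (i) to (iii) for every R, to (iii) for some R, to (ii), and
   back to (i). *)
have i_iii : (forall u : R, v < u -> exists x, supp mu x /\ ~ Wset u (f x)) ->
    forall Rm : 'M[R]_(1 + s, 1 + n), admissible L Rm -> cond_iii v Rm.
  move=> Hi Rm adm; apply: contrapT => nH.
  have [u vu hu] := not_cond_iii_Wset v0 adm nH.
  by have [x [_]] := Hi u vu; apply; exact: hu.
have forall_exists : (forall Rm : 'M[R]_(1 + s, 1 + n), admissible L Rm -> cond_iii v Rm) ->
    exists Rm : 'M[R]_(1 + s, 1 + n), admissible L Rm /\ cond_iii v Rm.
  by move=> H; have [Rm adm] := admissible_exists Laff; exists Rm; split => //; exact: H.
have iii_ii : (exists Rm : 'M[R]_(1 + s, 1 + n), admissible L Rm /\ cond_iii v Rm) ->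
    (omega_push mu f <= v%:E)%E.
  move=> [Rm [adm H]]; apply: ge_ereal_sup => _ [w hw <-].
  rewrite lee_fin leNgt; apply/negP => vw; have w0 : 0 <= w by apply: le_trans (ltW vw).
  have [Z [mZ Z0 hZ]] := Wset_negligible dist_metric fcont bes fed gd npl adm H nv vw.
  suff : (mu [set x | (w%:E < omega (f x))%E] <= 0)%E by rewrite leNgt hw.
  rewrite -Z0; apply: le_measure; rewrite ?inE//; first exact: measurable_lt_omega.
  move=> x /(lt_omegaP _ w0)[u wu Wu]; apply: hZ; exact: Wset_le (ltW wu) Wu.
have ii_i : (omega_push mu f <= v%:E)%E ->
    forall u : R, v < u -> exists x, supp mu x /\ ~ Wset u (f x).
  move=> Hii u vu; apply: contrapT => /forallNP nex.
  have allW x : supp mu x -> Wset u (f x).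
    by move=> sx; apply: contrapT => nW; apply: (nex x).
  (* Membership in W_u only gives [omega] above numbers less than u; the midpoint keeps such a
     number above [v]. *)
  pose w := (v + u) / 2; have vw : v < w by rewrite /w; lra.
  have wu : w < u by rewrite /w; lra.
  have w0 : 0 <= w by apply: le_trans (ltW vw).
  have : (omega_push mu f < w%:E)%E by apply: le_lt_trans Hii _; rewrite lte_fin.
  rewrite ltNge => /negP; apply; apply: ereal_sup_ubound; exists w => //=.
  have mA := measurable_lt_omega fcont w0.
  rewrite lt0e measure_ge0 andbT; apply/eqP => A0.
  have [Z [mZ Z0 hZ]] := negligible_compl_supp mu dist_metric bes.
  move: mu0; rewrite ltNge => /negP; apply.
  apply: (@le_trans _ _ (mu ([set x | (w%:E < omega (f x))%E] `|` Z))).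
    apply: le_measure; rewrite ?inE//; first exact: measurableU.
    move=> x _; have [sx|nsx] := pselect (supp mu x); last by right; exact: hZ.
    by left; apply/(lt_omegaP _ w0); exists u => //; exact: allW.
  apply: le_trans (measureU2 _ _ _) _ => //.
  rewrite -[leRHS]adde0; apply: leeD; rewrite le_eqVlt; apply/orP; left; apply/eqP.
    exact: A0.
  exact: Z0.
by split; [|split]; split; auto.
Qed.
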